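(* Let $f$ be analytic on $\mathbb{D}=\{z\in\mathbb{C}:|z|<1\}$ with $\operatorname{Diam} f(\mathbb{D})\le 2$. Then for all $z\in\mathbb{D}$, \[ |f(z)-f(0)|\le |z|\,\frac{2}{1+\sqrt{1-|z|^2}}. \] Moreover, equality holds in this inequality at some point of $\mathbb{D}\setminus\{0\}$ if and only if $f$ is a linear fractional transformation of the form \[ f(z)=c\,\frac{z-b}{1-\bar b z}+a \] for some constants $a\in\mathbb{C}$, $b\in\mathbb{D}\setminus\{0\}$ and $c\in\mathbb{C}$ with $|c|=1$.
   Context: $\operatorname{Diam} f(\mathbb{D})=\sup_{z,w\in\mathbb{D}}|f(z)-f(w)|$. *)

(* Defs.v *)
From Stdlib Require Import Reals.
From Coquelicot Require Import Coquelicot.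
Open Scope R_scope.

Definition in_disk (z : C) : Prop := Cmod z < 1.

Definition analytic_on_disk (f : C -> C) : Prop :=
  forall z : C, in_disk z -> @ex_derive C_AbsRing C_NormedModule f z.

Definition diam_image_le (f : C -> C) (d : R) : Prop :=
  forall z w : C, in_disk z -> in_disk w -> Cmod (f z - f w)%C <= d.

Definition dist_bound (z : C) : R := Cmod z * (2 / (1 + sqrt (1 - Cmod z ^ 2))).

(* Main.v *)
Require Import Defs.
From Stdlib Require Import Reals.
From Coquelicot Require Import Coquelicot.
From Stdlib Require Import Lra Psatz Classical ClassicalEpsilon.
Open Scope R_scope.

(** Let [b] be the hyperbolic midpoint of [0] and [z], and let [T] be the disk
    automorphism with [T b = z] and [T (- b) = 0].  With [h = f o T], Schwarz's lemma applied
    to [(h w - h (- w)) / 2] at [w = b] bounds [|f z - f 0|] by [2 |b|], which is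
    [dist_bound z].  In case of equality the odd part of [h] is [c w] with [|c| = 1].
    Schwarz's lemma for two-point functions also gives [Diam h(rD) <= 2 r], so antipodal
    points of each circle realise the diameter of the image; the first-order condition at
    this maximum says that [h' / c] is real, whence [h w = c w + h 0].

    Schwarz's lemma itself rests on the mean value property, obtained from Goursat's
    theorem on rectangles for [z |-> g (p + v exp z)]: the horizontal sides cancel by
    periodicity, and only continuity of [g] is needed at the centre [p], so that the
    quotient [h w / w] is admissible at [0]. *)

(** Only pointwise complex differentiability is used: no power series and no continuity of the
    derivative. Hence Goursat's theorem is proved with real integrals over the sides of rectangles,
    and the rigidity step recovers a function from its derivative by the mean value theorem instead
    of by integration. The hyperbolic midpoint is chosen because it turns the pair [z], [0] into the
    antipodal pair [b], [- b]: the increment of [f] becomes twice the odd part of [h] at [b], and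
    the diameter bound 2 says exactly that this odd part has modulus at most 1. *)

(** * Complex derivatives *)

(* Not [C_NormedModule], whose balls are squares: [is_derive_mult] and [is_derive_comp]
   need the target to carry the structure induced by [C_AbsRing]. *)
Definition cder (f : C -> C) (z l : C) : Prop :=
  @is_derive C_AbsRing (AbsRing_NormedModule C_AbsRing) f z l.

(** Spelled out with [Cmod], so that it does not depend on which uniform structure [C] carries. *)
Definition ccont (f : C -> C) (z : C) : Prop :=
  forall eps, 0 < eps -> exists d, 0 < d /\
    forall w, Cmod (w - z)%C < d -> Cmod (f w - f z)%C < eps.

Lemma cder_eps (f : C -> C) (z l : C) :
  cder f z l <->
  (forall eps, 0 < eps -> exists d, 0 < d /\
     forall w, Cmod (w - z)%C < d ->
       Cmod (f w - f z - l * (w - z))%C <= eps * Cmod (w - z)%C).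
Proof.
  split.
  - intros [_ H] eps Heps.
    destruct (H z (fun P HP => HP) (mkposreal _ Heps)) as [d Hd].
    exists d; split; [apply cond_pos|].
    intros w Hw. specialize (Hd w Hw). simpl in Hd.
    replace (l * (w - z))%C with ((w - z) * l)%C by ring. exact Hd.
  - intros H; split; [apply is_linear_scal_l|].
    intros x Hx.
    assert (x = z) as ->.
    { symmetry. apply (@is_filter_lim_locally_unique C_AbsRing (AbsRing_NormedModule C_AbsRing)).
      exact Hx. }
    intros eps. destruct (H eps (cond_pos eps)) as (d & Hd & H').
    exists (mkposreal _ Hd). intros w Hw. specialize (H' w Hw).
    replace (l * (w - z))%C with ((w - z) * l)%C in H' by ring. exact H'.
Qed.

(** The two structures on the codomain differ in their balls but share the norm, and the little-o
    clause of [is_derive] sees only the norm; the linearity clause is proved afresh. *)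
Lemma ex_derive_cder (f : C -> C) (z : C) :
  @ex_derive C_AbsRing C_NormedModule f z -> exists l, cder f z l.
Proof.
  intros [l [_ H]]. exists l. split; [apply is_linear_scal_l|exact H].
Qed.

Lemma cder_ext_ball (f g : C -> C) (z l : C) (r : R) : 0 < r ->
  (forall w, Cmod (w - z)%C < r -> f w = g w) -> cder f z l -> cder g z l.
Proof.
  intros Hr H. apply (is_derive_ext_loc (V := AbsRing_NormedModule C_AbsRing) f g).
  exists (mkposreal _ Hr). intros w Hw. apply H. exact Hw.
Qed.

Lemma cder_const (a z : C) : cder (fun _ => a) z 0.
Proof. exact (is_derive_const (V := AbsRing_NormedModule C_AbsRing) a z). Qed.

Lemma cder_id (z : C) : cder (fun w => w) z 1.
Proof. exact (is_derive_id (K := C_AbsRing) z). Qed.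

Lemma cder_plus (f g : C -> C) (z k l : C) :
  cder f z k -> cder g z l -> cder (fun w => f w + g w)%C z (k + l)%C.
Proof. exact (is_derive_plus (V := AbsRing_NormedModule C_AbsRing) f g z k l). Qed.

Lemma cder_minus (f g : C -> C) (z k l : C) :
  cder f z k -> cder g z l -> cder (fun w => f w - g w)%C z (k - l)%C.
Proof. exact (is_derive_minus (V := AbsRing_NormedModule C_AbsRing) f g z k l). Qed.

Lemma cder_mult (f g : C -> C) (z k l : C) :
  cder f z k -> cder g z l -> cder (fun w => f w * g w)%C z (k * g z + f z * l)%C.
Proof.
  intros Hf Hg. exact (is_derive_mult (K := C_AbsRing) f g z k l Hf Hg Cmult_comm).
Qed.

Lemma cder_comp (f g : C -> C) (z k l : C) :
  cder f (g z) k -> cder g z l -> cder (fun w => f (g w)) z (l * k)%C.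
Proof.
  intros Hf Hg.
  exact (is_derive_comp (K := C_AbsRing) (V := AbsRing_NormedModule C_AbsRing) f g z k l Hf Hg).
Qed.

Lemma cder_eq (f : C -> C) (z k l : C) : k = l -> cder f z k -> cder f z l.
Proof. intros ->; auto. Qed.

Lemma cder_ccont (f : C -> C) (z l : C) : cder f z l -> ccont f z.
Proof.
  intros H eps Heps. destruct (proj1 (cder_eps f z l) H 1 Rlt_0_1) as (d & Hd & H').
  assert (Hl := Cmod_ge_0 l).
  exists (Rmin d (eps / (2 + Cmod l))); split.
  - apply Rmin_pos; [|apply Rdiv_lt_0_compat]; lra.
  - intros w Hw.
    assert (Hw1 := Rlt_le_trans _ _ _ Hw (Rmin_l _ _)).
    assert (Hw2 := Rlt_le_trans _ _ _ Hw (Rmin_r _ _)).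
    specialize (H' w Hw1).
    replace (f w - f z)%C with ((f w - f z - l * (w - z)) + l * (w - z))%C by ring.
    apply Rle_lt_trans with (1 := Cmod_triangle _ _). rewrite (Cmod_mult l).
    apply Rmult_lt_compat_r with (r := 2 + Cmod l) in Hw2; [|lra].
    replace (eps / (2 + Cmod l) * (2 + Cmod l)) with eps in Hw2 by (field; lra).
    assert (Hw3 := Cmod_ge_0 (w - z)%C). nra.
Qed.

Lemma cder_inv (z : C) : z <> 0%C -> cder Cinv z (- / (z * z))%C.
Proof.
  intros Hz. apply cder_eps. intros eps Heps.
  assert (Hm : 0 < Cmod z) by (apply Cmod_gt_0; exact Hz).
  (* The error is exactly (w - z)^2 / (w z^2). The first radius forces |w| > |z| / 2, and then the
     second gives |w - z| <= eps |w| |z|^2. *)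
  exists (Rmin (Cmod z / 2) (eps * (Cmod z ^ 3) / 2)); split.
  - apply Rmin_pos; [lra|]. apply Rdiv_lt_0_compat; [|lra].
    apply Rmult_lt_0_compat; [lra|apply pow_lt; lra].
  - intros w Hw.
    assert (Hw1 := Rlt_le_trans _ _ _ Hw (Rmin_l _ _)).
    assert (Hw2 := Rlt_le_trans _ _ _ Hw (Rmin_r _ _)).
    assert (Hmw : Cmod z / 2 < Cmod w).
    { assert (H := Cmod_triangle w (- (w - z))%C).
      replace (w + - (w - z))%C with z in H by ring.
      rewrite Cmod_opp in H. lra. }
    assert (Hw0 : w <> 0%C) by (apply Cmod_gt_0; lra).
    replace (/ w - / z - - / (z * z) * (w - z))%C
      with ((w - z) * ((w - z) / (w * (z * z))))%C by (field; auto).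
    rewrite Cmod_mult, Cmod_div by (repeat apply Cmult_neq_0; auto).
    rewrite !Cmod_mult, Rmult_comm.
    apply Rmult_le_compat_r; [apply Cmod_ge_0|].
    assert (Hzz : 0 < Cmod z * Cmod z) by (apply Rmult_lt_0_compat; lra).
    assert (Hwzz : 0 < Cmod w * (Cmod z * Cmod z)) by (apply Rmult_lt_0_compat; lra).
    apply Rmult_le_reg_r with (Cmod w * (Cmod z * Cmod z)); [exact Hwzz|].
    unfold Rdiv. rewrite Rmult_assoc, Rinv_l, Rmult_1_r by lra.
    assert (eps * (Cmod z * Cmod z) * (Cmod z / 2) <= eps * (Cmod z * Cmod z) * Cmod w).
    { apply Rmult_le_compat_l; [apply Rmult_le_pos|]; lra. }
    nra.
Qed.

Lemma cder_div (f g : C -> C) (z k l : C) : g z <> 0%C ->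
  cder f z k -> cder g z l -> exists m, cder (fun w => f w / g w)%C z m.
Proof.
  intros Hz Hf Hg. eexists. unfold Cdiv. apply cder_mult; [exact Hf|].
  apply cder_comp with (f := Cinv); [apply cder_inv, Hz|exact Hg].
Qed.

Lemma Cmod_pair_le (x y : R) : Cmod (x, y) <= Rabs x + Rabs y.
Proof.
  unfold Cmod; simpl. apply Rsqr_incr_0_var.
  - rewrite Rsqr_sqrt by nra. unfold Rsqr.
    assert (Hx := Rabs_pos x); assert (Hy := Rabs_pos y).
    assert (Ex : x * x = Rabs x * Rabs x) by (rewrite <- Rabs_mult; symmetry; apply Rabs_pos_eq; nra).
    assert (Ey : y * y = Rabs y * Rabs y) by (rewrite <- Rabs_mult; symmetry; apply Rabs_pos_eq; nra).
    nra.
  - assert (Hx := Rabs_pos x); assert (Hy := Rabs_pos y). lra.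
Qed.

Lemma im_le_Cmod (c : C) : Rabs (Im c) <= Cmod c.
Proof. apply Rle_trans with (2 := Rmax_Cmod c). apply Rmax_r. Qed.

(** * The complex exponential *)

Definition cexp (z : C) : C := (exp (Re z) * cos (Im z), exp (Re z) * sin (Im z)).

Lemma Cmod_cexp (z : C) : Cmod (cexp z) = exp (Re z).
Proof.
  unfold cexp, Cmod; simpl.
  replace (exp (Re z) * cos (Im z) * (exp (Re z) * cos (Im z) * 1) +
    exp (Re z) * sin (Im z) * (exp (Re z) * sin (Im z) * 1))
    with (Rsqr (exp (Re z)) * (Rsqr (sin (Im z)) + Rsqr (cos (Im z))))
    by (unfold Rsqr; ring).
  rewrite sin2_cos2, Rmult_1_r. apply sqrt_Rsqr. left; apply exp_pos.
Qed.

Lemma cexp_plus (z w : C) : cexp (z + w)%C = (cexp z * cexp w)%C.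
Proof.
  unfold cexp. rewrite re_plus, im_plus, exp_plus, cos_plus, sin_plus.
  unfold Cmult; simpl. f_equal; ring.
Qed.

Lemma derivable_pt_lim_bound (g : R -> R) (l eps : R) :
  derivable_pt_lim g 0 l -> 0 < eps -> exists d, 0 < d /\
  forall h, Rabs h < d -> Rabs (g h - g 0 - l * h) <= eps * Rabs h.
Proof.
  intros H Heps. destruct (H eps Heps) as [d Hd]. exists d; split; [apply cond_pos|].
  intros h Hh. destruct (Req_dec h 0) as [->|Hh0].
  - rewrite Rmult_0_r, Rminus_diag, Rminus_0_r, Rabs_R0. lra.
  - specialize (Hd h Hh0 Hh). rewrite Rplus_0_l in Hd.
    replace (g h - g 0 - l * h) with (((g h - g 0) / h - l) * h) by (field; auto).
    rewrite Rabs_mult. apply Rmult_le_compat_r; [apply Rabs_pos|lra].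
Qed.

(** Both components reduce to the first-order errors of [exp], [sin] and [cos] at 0, plus the
    quadratic term (exp s - 1) sin t. The caps at 1 give the crude bounds exp s <= 3, |exp s - 1| <=
    2|s| and |sin t| <= 2|t|; the radius eps / 12 turns the quadratic term into eps / 3 times the
    modulus, and the errors total 5/6 eps. *)
Lemma cder_cexp_0 : cder cexp 0 1.
Proof.
  apply cder_eps. intros eps Heps.
  destruct (derivable_pt_lim_bound exp 1 (Rmin 1 (eps / 6))) as (d1 & Hd1 & H1).
  { rewrite <- exp_0. apply derivable_pt_lim_exp. }
  { apply Rmin_pos; lra. }
  destruct (derivable_pt_lim_bound sin 1 (Rmin 1 (eps / 6))) as (d2 & Hd2 & H2).
  { rewrite <- cos_0. apply derivable_pt_lim_sin. }
  { apply Rmin_pos; lra. }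
  destruct (derivable_pt_lim_bound cos 0 (eps / 18)) as (d3 & Hd3 & H3).
  { replace 0 with (- sin 0) at 2 by (rewrite sin_0; ring). apply derivable_pt_lim_cos. }
  { lra. }
  exists (Rmin (Rmin d1 d2) (Rmin d3 (Rmin 1 (eps / 12)))); split.
  { repeat apply Rmin_pos; lra. }
  intros w Hw. replace (w - 0)%C with w in * by ring.
  assert (Hwa := Rlt_le_trans _ _ _ Hw (Rmin_l _ _)).
  assert (Hwb := Rlt_le_trans _ _ _ Hw (Rmin_r _ _)). clear Hw.
  assert (Hw1 := Rlt_le_trans _ _ _ Hwa (Rmin_l _ _)).
  assert (Hw2 := Rlt_le_trans _ _ _ Hwa (Rmin_r _ _)).
  assert (Hw3 := Rlt_le_trans _ _ _ Hwb (Rmin_l _ _)).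
  assert (Hwc := Rlt_le_trans _ _ _ Hwb (Rmin_r _ _)).
  assert (Hw4 := Rlt_le_trans _ _ _ Hwc (Rmin_l _ _)).
  assert (Hw5 := Rlt_le_trans _ _ _ Hwc (Rmin_r _ _)). clear Hwa Hwb Hwc.
  assert (Hr := re_le_Cmod w). assert (Hi := im_le_Cmod w).
  destruct w as [s t]. simpl in Hr, Hi.
  assert (Hm := Cmod_pair_le s t).
  specialize (H1 s ltac:(lra)). specialize (H2 t ltac:(lra)). specialize (H3 t ltac:(lra)).
  rewrite exp_0 in H1. rewrite sin_0 in H2. rewrite cos_0 in H3.
  set (M := Cmod (s, t)) in *.
  assert (Hs := Rabs_pos s); assert (Ht := Rabs_pos t).
  assert (Hmin1 := Rmin_l 1 (eps / 6)). assert (Hmin2 := Rmin_r 1 (eps / 6)).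
  assert (Ee : exp s <= 3).
  { assert (Rmin 1 (eps / 6) * Rabs s <= 1 * Rabs s) by (apply Rmult_le_compat_r; lra).
    apply Rabs_le_between in H1. assert (Hs' := Rle_abs s). lra. }
  assert (Ee1 : Rabs (exp s - 1) <= 2 * Rabs s).
  { replace (exp s - 1) with ((exp s - 1 - 1 * s) + s) by ring.
    apply Rle_trans with (1 := Rabs_triang _ _).
    assert (Rmin 1 (eps / 6) * Rabs s <= 1 * Rabs s) by (apply Rmult_le_compat_r; lra). lra. }
  assert (Es : Rabs (sin t) <= 2 * Rabs t).
  { replace (sin t) with ((sin t - 0 - 1 * t) + t) by ring.
    apply Rle_trans with (1 := Rabs_triang _ _).
    assert (Rmin 1 (eps / 6) * Rabs t <= 1 * Rabs t) by (apply Rmult_le_compat_r; lra). lra. }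
  assert (H1' : Rabs (exp s - 1 - 1 * s) <= eps / 6 * Rabs s).
  { apply Rle_trans with (1 := H1). apply Rmult_le_compat_r; lra. }
  assert (H2' : Rabs (sin t - 0 - 1 * t) <= eps / 6 * Rabs t).
  { apply Rle_trans with (1 := H2). apply Rmult_le_compat_r; lra. }
  assert (Hex := exp_pos s).
  assert (A : Rabs (exp s * cos t - 1 - s) <= eps / 6 * M + eps / 6 * M).
  { replace (exp s * cos t - 1 - s)
      with ((exp s - 1 - 1 * s) + exp s * (cos t - 1 - 0 * t)) by ring.
    apply Rle_trans with (1 := Rabs_triang _ _). rewrite Rabs_mult, (Rabs_pos_eq (exp s)) by lra.
    assert (exp s * Rabs (cos t - 1 - 0 * t) <= 3 * (eps / 18 * Rabs t)).
    { apply Rmult_le_compat; try apply Rabs_pos; lra. }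
    nra. }
  assert (B : Rabs (exp s * sin t - t) <= eps / 6 * M + eps / 3 * M).
  { replace (exp s * sin t - t)
      with ((sin t - 0 - 1 * t) + (exp s - 1) * sin t) by ring.
    apply Rle_trans with (1 := Rabs_triang _ _). rewrite Rabs_mult.
    assert (Rabs (exp s - 1) * Rabs (sin t) <= (2 * (eps / 12)) * (2 * M)).
    { apply Rmult_le_compat; try apply Rabs_pos; lra. }
    nra. }
  replace (cexp (s, t) - cexp 0 - 1 * (s, t))%C
    with (exp s * cos t - 1 - s, exp s * sin t - t)
    by (unfold cexp, Cminus, Cmult, Cplus, Copp; simpl;
        rewrite exp_0, cos_0, sin_0; f_equal; ring).
  apply Rle_trans with (1 := Cmod_pair_le _ _). nra.
Qed.

Lemma cder_cexp (z : C) : cder cexp z (cexp z).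
Proof.
  apply cder_ext_ball with (f := fun w => (cexp z * cexp (w - z))%C) (r := 1); [lra| |].
  - intros w _. rewrite <- cexp_plus. f_equal. ring.
  - apply cder_eq with (k := (0 * cexp (z - z) + cexp z * ((1 - 0) * 1))%C); [ring|].
    apply cder_mult with (f := fun _ => cexp z) (g := fun w => cexp (w - z)); [apply cder_const|].
    apply cder_comp with (f := cexp) (g := fun w => (w - z)%C).
    + replace (z - z)%C with (RtoC 0) by ring. apply cder_cexp_0.
    + apply cder_minus; [apply cder_id|apply cder_const].
Qed.

(** * Goursat's theorem on rectangles *)

Lemma nested_intervals (a b : nat -> R) :
  (forall n, a n <= a (S n)) -> (forall n, b (S n) <= b n) -> (forall n, a n <= b n) ->
  exists x, forall n, a n <= x <= b n.
Proof.
  intros Ha Hb Hab.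
  assert (Ha' : forall n k, a n <= a (n + k)%nat).
  { intros n k; induction k as [|k IH]; [rewrite Nat.add_0_r; lra|].
    rewrite Nat.add_succ_r. specialize (Ha (n + k)%nat). lra. }
  assert (Hb' : forall n k, b (n + k)%nat <= b n).
  { intros n k; induction k as [|k IH]; [rewrite Nat.add_0_r; lra|].
    rewrite Nat.add_succ_r. specialize (Hb (n + k)%nat). lra. }
  assert (H : forall m n, a m <= b n).
  { intros m n. apply Rle_trans with (1 := Ha' m n). rewrite Nat.add_comm.
    apply Rle_trans with (1 := Hab _). apply Hb'. }
  destruct (completeness (fun x => exists n, x = a n)) as [x [Hx1 Hx2]].
  - exists (b 0%nat). intros y [n ->]. apply H.
  - exists (a 0%nat), 0%nat. reflexivity.
  - exists x. intros n; split; [apply Hx1; exists n; reflexivity|].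
    apply Hx2. intros y [m ->]. apply H.
Qed.

(** Repeated quartering of a counterexample closes in on a point, where the local hypothesis refutes
    it. Phrased as an induction principle, this serves both Goursat's theorem and the compactness of
    the disk. *)
Lemma rectangle_bisection (P : R -> R -> R -> R -> Prop) (a b c d : R) :
  a <= b -> c <= d ->
  (forall a' b' c' d', a <= a' <= b' -> b' <= b -> c <= c' <= d' -> d' <= d ->
     P a' ((a' + b') / 2) c' ((c' + d') / 2) -> P ((a' + b') / 2) b' c' ((c' + d') / 2) ->
     P a' ((a' + b') / 2) ((c' + d') / 2) d' -> P ((a' + b') / 2) b' ((c' + d') / 2) d' ->
     P a' b' c' d') ->
  (forall x y, a <= x <= b -> c <= y <= d -> exists e, 0 < e /\
     forall a' b' c' d', a <= a' <= x -> x <= b' <= b -> c <= c' <= y -> y <= d' <= d ->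
       b' - a' < e -> d' - c' < e -> P a' b' c' d') ->
  P a b c d.
Proof.
  intros Hab Hcd Hsplit Hloc. apply NNPP. intros HP.
  set (bad := fun q : (R * R) * (R * R) =>
    let '((a', b'), (c', d')) := q in
    (a <= a' <= b' /\ b' <= b /\ c <= c' <= d' /\ d' <= d) /\ ~ P a' b' c' d').
  set (half := fun q q' : (R * R) * (R * R) =>
    let '((a0, b0), (c0, d0)) := q in let '((a1, b1), (c1, d1)) := q' in
    (a0 <= a1 /\ b1 <= b0 /\ b1 - a1 = (b0 - a0) / 2) /\
    (c0 <= c1 /\ d1 <= d0 /\ d1 - c1 = (d0 - c0) / 2)).
  (* Choice selects a bad quarter of each bad rectangle; the subset type carries badness along the
     iteration [Q]. *)
  assert (Hstep : forall q : {q | bad q}, {q' : {q | bad q} | half (proj1_sig q) (proj1_sig q')}).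
  { intros [[[a0 b0] [c0 d0]] [Hin Hbad]]. apply constructive_indefinite_description.
    simpl.
    assert (E : exists q', bad q' /\ half ((a0, b0), (c0, d0)) q').
    { apply NNPP. intros Hn. apply Hbad. apply Hsplit; try tauto;
        apply NNPP; intros Hn'; apply Hn.
      - exists ((a0, (a0 + b0) / 2), (c0, (c0 + d0) / 2)). simpl. repeat split; try assumption; lra.
      - exists (((a0 + b0) / 2, b0), (c0, (c0 + d0) / 2)). simpl. repeat split; try assumption; lra.
      - exists ((a0, (a0 + b0) / 2), ((c0 + d0) / 2, d0)). simpl. repeat split; try assumption; lra.
      - exists (((a0 + b0) / 2, b0), ((c0 + d0) / 2, d0)). simpl. repeat split; try assumption; lra. }
    destruct E as [q' [Hq1 Hq2]]. exists (exist _ q' Hq1). exact Hq2. }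
  assert (H0 : bad ((a, b), (c, d))) by (simpl; repeat split; try assumption; lra).
  set (Q := fix Q n := match n with O => exist _ _ H0 | S n => proj1_sig (Hstep (Q n)) end).
  assert (HQ : forall n, half (proj1_sig (Q n)) (proj1_sig (Q (S n)))).
  { intros n. simpl. destruct (Hstep (Q n)) as [q' Hq']. exact Hq'. }
  set (an := fun n => fst (fst (proj1_sig (Q n)))). set (bn := fun n => snd (fst (proj1_sig (Q n)))).
  set (cn := fun n => fst (snd (proj1_sig (Q n)))). set (dn := fun n => snd (snd (proj1_sig (Q n)))).
  assert (Hbadn : forall n, (a <= an n <= bn n /\ bn n <= b /\ c <= cn n <= dn n /\ dn n <= d) /\
    ~ P (an n) (bn n) (cn n) (dn n)).
  { intros n. unfold an, bn, cn, dn. assert (Hq := proj2_sig (Q n)). cbv beta in Hq.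
    destruct (proj1_sig (Q n)) as [[? ?] [? ?]]. exact Hq. }
  assert (Hhalf : forall n,
    (an n <= an (S n) /\ bn (S n) <= bn n /\ bn (S n) - an (S n) = (bn n - an n) / 2) /\
    (cn n <= cn (S n) /\ dn (S n) <= dn n /\ dn (S n) - cn (S n) = (dn n - cn n) / 2)).
  { intros n. specialize (HQ n). unfold an, bn, cn, dn.
    destruct (proj1_sig (Q n)) as [[? ?] [? ?]].
    destruct (proj1_sig (Q (S n))) as [[? ?] [? ?]]. exact HQ. }
  clearbody an bn cn dn. clear Q HQ Hstep bad half H0.
  destruct (nested_intervals an bn) as [x Hx]; try (intros n; specialize (Hhalf n); specialize (Hbadn n); tauto).
  destruct (nested_intervals cn dn) as [y Hy]; try (intros n; specialize (Hhalf n); specialize (Hbadn n); tauto).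
  assert (Hlen : forall n, bn n - an n = (bn 0%nat - an 0%nat) * (/ 2) ^ n /\
                           dn n - cn n = (dn 0%nat - cn 0%nat) * (/ 2) ^ n).
  { induction n as [|n [IH1 IH2]]; [simpl; lra|].
    destruct (Hhalf n) as [(_ & _ & ->) (_ & _ & ->)]. rewrite IH1, IH2. simpl. lra. }
  destruct (Hloc x y) as (e & He & Hloc').
  { specialize (Hx 0%nat). destruct (Hbadn 0%nat). lra. }
  { specialize (Hy 0%nat). destruct (Hbadn 0%nat). lra. }
  (* [L] dominates both side lengths, so one [N] serves both; the [+ 1] keeps it positive for a
     degenerate rectangle. *)
  set (L := (bn 0%nat - an 0%nat) + (dn 0%nat - cn 0%nat) + 1).
  assert (Hpos : 0 <= bn 0%nat - an 0%nat /\ 0 <= dn 0%nat - cn 0%nat)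
    by (destruct (Hbadn 0%nat); lra).
  destruct (pow_lt_1_zero (/ 2)) with (y := e / L) as [N HN].
  { rewrite Rabs_pos_eq; lra. }
  { apply Rdiv_lt_0_compat; unfold L; lra. }
  specialize (HN N (le_n _)). rewrite Rabs_pos_eq in HN by (apply pow_le; lra).
  apply Rmult_lt_compat_r with (r := L) in HN; [|unfold L; lra].
  replace (e / L * L) with e in HN by (field; unfold L; lra).
  assert (Hp : 0 <= (/ 2) ^ N) by (apply pow_le; lra).
  destruct (Hlen N) as [E1 E2]. specialize (Hx N). specialize (Hy N).
  destruct (Hbadn N) as [Hin Hbad]. apply Hbad.
  apply Hloc'; try lra; unfold L in HN; nra.
Qed.

Lemma continuous_on_line (f : C -> C) (p v : C) (t : R) :
  ccont f (p + t * v)%C ->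
  continuous (fun s : R => Re (f (p + s * v)%C)) t /\
  continuous (fun s : R => Im (f (p + s * v)%C)) t.
Proof.
  intros H.
  assert (K : forall eps : posreal, exists d : posreal, forall s, Rabs (s - t) < d ->
    Cmod (f (p + s * v) - f (p + t * v))%C < eps).
  { intros eps. destruct (H eps (cond_pos eps)) as (d & Hd & Hd').
    assert (Hv := Cmod_ge_0 v).
    assert (Hp : 0 < d / (1 + Cmod v)) by (apply Rdiv_lt_0_compat; lra).
    exists (mkposreal _ Hp). simpl. intros s Hs. apply Hd'.
    replace (p + s * v - (p + t * v))%C with ((s - t)%R * v)%C by (rewrite RtoC_minus; ring).
    rewrite Cmod_mult, Cmod_R.
    apply Rmult_lt_compat_r with (r := 1 + Cmod v) in Hs; [|lra].
    replace (d / (1 + Cmod v) * (1 + Cmod v)) with d in Hs by (field; lra).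
    assert (Hs' := Rabs_pos (s - t)). nra. }
  split; apply filterlim_locally; intros eps; destruct (K eps) as [d Hd];
    exists d; intros s Hs; specialize (Hd s Hs).
  - change (Rabs (Re (f (p + s * v)%C) - Re (f (p + t * v)%C)) < eps).
    unfold Rminus. rewrite <- re_opp, <- re_plus.
    exact (Rle_lt_trans _ _ _ (re_le_Cmod _) Hd).
  - change (Rabs (Im (f (p + s * v)%C) - Im (f (p + t * v)%C)) < eps).
    unfold Rminus. rewrite <- im_opp, <- im_plus.
    exact (Rle_lt_trans _ _ _ (im_le_Cmod _) Hd).
Qed.

Lemma continuous_horizontal (G : C -> C) (x y : R) : ccont G (x, y) ->
  continuous (fun s : R => Re (G (s, y))) x /\ continuous (fun s : R => Im (G (s, y))) x.
Proof.
  assert (E : forall s : R, (s, y) = ((0, y) + s * 1)%C)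
    by (intros s; unfold Cplus, Cmult, RtoC; simpl; f_equal; ring).
  intros H. rewrite E in H. destruct (continuous_on_line _ _ _ _ H) as [H1 H2].
  split; [eapply continuous_ext; [|exact H1]|eapply continuous_ext; [|exact H2]];
    intros s; cbv beta; rewrite <- E; reflexivity.
Qed.

Lemma continuous_vertical (G : C -> C) (x y : R) : ccont G (x, y) ->
  continuous (fun s : R => Re (G (x, s))) y /\ continuous (fun s : R => Im (G (x, s))) y.
Proof.
  assert (E : forall s : R, (x, s) = ((x, 0) + s * Ci)%C)
    by (intros s; unfold Cplus, Cmult, RtoC, Ci; simpl; f_equal; ring).
  intros H. rewrite E in H. destruct (continuous_on_line _ _ _ _ H) as [H1 H2].
  split; [eapply continuous_ext; [|exact H1]|eapply continuous_ext; [|exact H2]];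
    intros s; cbv beta; rewrite <- E; reflexivity.
Qed.

Lemma RInt_near_const (f : R -> R) (a b k e : R) : a <= b -> ex_RInt f a b ->
  (forall t, a <= t <= b -> Rabs (f t - k) <= e) ->
  Rabs (RInt f a b - (b - a) * k) <= (b - a) * e.
Proof.
  intros Hab Hf H.
  replace (RInt f a b - (b - a) * k) with (RInt (fun t => f t - k) a b).
  - apply abs_RInt_le_const; [exact Hab| |exact H].
    apply (ex_RInt_minus (V := R_NormedModule)); [exact Hf|apply ex_RInt_const].
  - assert (E := RInt_minus (V := R_CompleteNormedModule) f (fun _ => k) a b Hf (ex_RInt_const _ _ _)).
    rewrite RInt_const in E. exact E.
Qed.

(** Near a point of differentiability [G] is affine up to a small error. By the Cauchy-Riemann
    equations the same number [Re l] governs the horizontal increment of [Re G] and the vertical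
    increment of [Im G], so that after integration both produce [Re l] times the area. *)
Lemma cder_rectangle_estimate (G : C -> C) (x0 y0 : R) (l : C) (eps : R) :
  cder G (x0, y0) l -> 0 < eps -> exists e, 0 < e /\
  forall a b c d, a <= x0 <= b -> c <= y0 <= d -> b - a < e -> d - c < e ->
    (forall y, c <= y <= d ->
       Rabs (Re (G (b, y)) - Re (G (a, y)) - Re l * (b - a)) <= 2 * eps * ((b - a) + (d - c))) /\
    (forall x, a <= x <= b ->
       Rabs (Im (G (x, d)) - Im (G (x, c)) - Re l * (d - c)) <= 2 * eps * ((b - a) + (d - c))).
Proof.
  intros H Heps. destruct (proj1 (cder_eps _ _ _) H eps Heps) as (dl & Hdl & H').
  exists (dl / 2); split; [lra|]. intros a b c d Hx0 Hy0 Hab Hcd.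
  assert (K : forall x y, a <= x <= b -> c <= y <= d ->
    Cmod (G (x, y) - G (x0, y0) - l * ((x, y) - (x0, y0)))%C <= eps * ((b - a) + (d - c))).
  { intros x y Hx Hy.
    assert (E : Cmod ((x, y) - (x0, y0))%C <= (b - a) + (d - c)).
    { unfold Cminus, Cplus, Copp; simpl. apply Rle_trans with (1 := Cmod_pair_le _ _).
      apply Rplus_le_compat; apply Rabs_le; lra. }
    apply Rle_trans with (1 := H' (x, y) ltac:(lra)).
    apply Rmult_le_compat_l; lra. }
  split.
  - intros y Hy.
    assert (K1 := Rle_trans _ _ _ (re_le_Cmod _) (K b y ltac:(lra) Hy)).
    assert (K2 := Rle_trans _ _ _ (re_le_Cmod _) (K a y ltac:(lra) Hy)).
    apply Rabs_le_between in K1, K2. apply Rabs_le.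
    unfold Cminus in K1, K2. repeat rewrite ?re_plus, ?re_opp, ?re_mult, ?im_plus, ?im_opp in K1, K2.
    simpl in K1, K2. nra.
  - intros x Hx.
    assert (K1 := Rle_trans _ _ _ (im_le_Cmod _) (K x d Hx ltac:(lra))).
    assert (K2 := Rle_trans _ _ _ (im_le_Cmod _) (K x c Hx ltac:(lra))).
    apply Rabs_le_between in K1, K2. apply Rabs_le.
    unfold Cminus in K1, K2. repeat rewrite ?im_plus, ?im_opp, ?im_mult, ?re_plus, ?re_opp in K1, K2.
    simpl in K1, K2. nra.
Qed.

(* This is the imaginary part of Cauchy's theorem for the boundary of the rectangle. *)
Lemma goursat_rectangle (G : C -> C) (a b c d : R) : a <= b -> c <= d ->
  (forall x y, a <= x <= b -> c <= y <= d -> exists l, cder G (x, y) l) ->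
  RInt (fun x => Im (G (x, d))) a b - RInt (fun x => Im (G (x, c))) a b =
  RInt (fun y => Re (G (b, y))) c d - RInt (fun y => Re (G (a, y))) c d.
Proof.
  intros Hab Hcd HG.
  assert (HRe : forall x y1 y2, a <= x <= b -> c <= y1 <= y2 -> y2 <= d ->
    ex_RInt (fun y => Re (G (x, y))) y1 y2).
  { intros x y1 y2 Hx Hy1 Hy2. apply (ex_RInt_continuous (V := R_CompleteNormedModule)).
    rewrite Rmin_left, Rmax_right by lra. intros y Hy.
    destruct (HG x y Hx ltac:(lra)) as [l Hl].
    apply (continuous_vertical G x y), (cder_ccont _ _ _ Hl). }
  assert (HIm : forall y x1 x2, c <= y <= d -> a <= x1 <= x2 -> x2 <= b ->
    ex_RInt (fun x => Im (G (x, y))) x1 x2).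
  { intros y x1 x2 Hy Hx1 Hx2. apply (ex_RInt_continuous (V := R_CompleteNormedModule)).
    rewrite Rmin_left, Rmax_right by lra. intros x Hx.
    destruct (HG x y ltac:(lra) Hy) as [l Hl].
    apply (continuous_horizontal G x y), (cder_ccont _ _ _ Hl). }
  set (J := fun a b c d =>
    (RInt (fun y => Re (G (b, y))) c d - RInt (fun y => Re (G (a, y))) c d) -
    (RInt (fun x => Im (G (x, d))) a b - RInt (fun x => Im (G (x, c))) a b)).
  (* The bound is quadratic in the half-perimeter: the four quarters each contribute a quarter of
     it, so their sum is exactly the bound for the whole. *)
  assert (Main : forall eps, 0 < eps -> Rabs (J a b c d) <= 2 * eps * ((b - a) + (d - c)) ^ 2).
  { intros eps Heps.
    apply (rectangle_bisection (fun a b c d => Rabs (J a b c d) <= 2 * eps * ((b - a) + (d - c)) ^ 2));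
      [exact Hab|exact Hcd| |].
    - intros a' b' c' d' Ha Hb Hc Hd H1 H2 H3 H4.
      set (m := (a' + b') / 2) in *. set (n := (c' + d') / 2) in *.
      assert (Hm : a' <= m <= b') by (unfold m; lra).
      assert (Hn : c' <= n <= d') by (unfold n; lra).
      assert (CR : forall x, a <= x <= b -> RInt (fun y => Re (G (x, y))) c' d' =
        RInt (fun y => Re (G (x, y))) c' n + RInt (fun y => Re (G (x, y))) n d').
      { intros x Hx. symmetry. apply (RInt_Chasles (V := R_CompleteNormedModule)); apply HRe; lra. }
      assert (CI : forall y, c <= y <= d -> RInt (fun x => Im (G (x, y))) a' b' =
        RInt (fun x => Im (G (x, y))) a' m + RInt (fun x => Im (G (x, y))) m b').
      { intros y Hy. symmetry. apply (RInt_Chasles (V := R_CompleteNormedModule)); apply HIm; lra. }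
      assert (E : J a' b' c' d' = (J a' m c' n + J m b' c' n) + (J a' m n d' + J m b' n d')).
      { unfold J. rewrite !CR, !CI by lra. ring. }
      rewrite E.
      apply Rle_trans with (1 := Rabs_triang _ _).
      assert (T1 := Rabs_triang (J a' m c' n) (J m b' c' n)).
      assert (T2 := Rabs_triang (J a' m n d') (J m b' n d')).
      replace (m - a') with ((b' - a') / 2) in * by (unfold m; field).
      replace (b' - m) with ((b' - a') / 2) in * by (unfold m; field).
      replace (n - c') with ((d' - c') / 2) in * by (unfold n; field).
      replace (d' - n) with ((d' - c') / 2) in * by (unfold n; field).
      lra.
    - intros x y Hx Hy. destruct (HG x y Hx Hy) as [l Hl].
      destruct (cder_rectangle_estimate G x y l eps Hl Heps) as (e & He & H).
      exists e; split; [exact He|]. intros a' b' c' d' Ha Hb Hc Hd Hw Hh.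
      destruct (H a' b' c' d' ltac:(lra) ltac:(lra) Hw Hh) as [E1 E2].
      (* Both integrals approximate [Re l] times the area, which cancels in [J]; their errors carry
         the factors height and width and add up to the quadratic bound. *)
      assert (F1 : Rabs (RInt (fun y => Re (G (b', y)) - Re (G (a', y))) c' d' - (d' - c') * (Re l * (b' - a')))
        <= (d' - c') * (2 * eps * ((b' - a') + (d' - c')))).
      { apply RInt_near_const; [lra| |exact E1].
        apply (ex_RInt_minus (V := R_NormedModule)); apply HRe; lra. }
      assert (F2 : Rabs (RInt (fun x => Im (G (x, d')) - Im (G (x, c'))) a' b' - (b' - a') * (Re l * (d' - c')))
        <= (b' - a') * (2 * eps * ((b' - a') + (d' - c')))).
      { apply RInt_near_const; [lra| |exact E2].
        apply (ex_RInt_minus (V := R_NormedModule)); apply HIm; lra. }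
      assert (G1 := RInt_minus (V := R_CompleteNormedModule) (fun y => Re (G (b', y))) (fun y => Re (G (a', y)))
        c' d' ltac:(apply HRe; lra) ltac:(apply HRe; lra)).
      assert (G2 := RInt_minus (V := R_CompleteNormedModule) (fun x => Im (G (x, d'))) (fun x => Im (G (x, c')))
        a' b' ltac:(apply HIm; lra) ltac:(apply HIm; lra)).
      unfold minus, plus, opp in G1, G2; simpl in G1, G2. unfold Rminus in F1 at 2, F2 at 2.
      unfold J.
      match type of G1 with ?u = ?v => match type of G2 with ?u' = ?v' =>
        assert (F1' : Rabs (v - (d' - c') * (Re l * (b' - a'))) <=
          (d' - c') * (2 * eps * ((b' - a') + (d' - c')))) by (rewrite <- G1; exact F1);
        assert (F2' : Rabs (v' - (b' - a') * (Re l * (d' - c'))) <=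
          (b' - a') * (2 * eps * ((b' - a') + (d' - c')))) by (rewrite <- G2; exact F2) end end.
      apply Rabs_le_between in F1', F2'. apply Rabs_le. lra. }
  enough (E : J a b c d = 0) by (unfold J in E; lra).
  apply NNPP. intros HJ. apply Rabs_pos_lt in HJ.
  set (K := ((b - a) + (d - c)) ^ 2) in *.
  assert (HK : 0 <= K) by (apply pow2_ge_0).
  (* With this eps, [Main] would give |J| <= |J| / 2. *)
  assert (Hp : 0 < Rabs (J a b c d) / (4 * (K + 1))) by (apply Rdiv_lt_0_compat; lra).
  specialize (Main _ Hp).
  replace (2 * (Rabs (J a b c d) / (4 * (K + 1))) * K)
    with (Rabs (J a b c d) / 2 * (K / (K + 1))) in Main by (field; lra).
  assert (K / (K + 1) <= 1).
  { apply Rmult_le_reg_r with (K + 1); [lra|]. unfold Rdiv.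
    rewrite Rmult_assoc, Rinv_l by lra. lra. }
  nra.
Qed.

(** * Mean value property and maximum principle *)

(** The circle mean does not depend on [s], and it tends to [Re (g p)] as [s] goes to minus
    infinity. The real part is all that the maximum principle asks for. *)
Lemma mean_value_property (g : C -> C) (p v : C) (r s : R) :
  v <> 0%C -> ccont g p ->
  (forall w, w <> p -> Cmod (w - p)%C < r -> exists l, cder g w l) ->
  Cmod v * exp s < r ->
  RInt (fun t => Re (g (p + v * cexp (s, t))%C)) 0 (2 * PI) = 2 * PI * Re (g p).
Proof.
  intros Hv Hcont Hder Hs.
  assert (Hv' : 0 < Cmod v) by (apply Cmod_gt_0; exact Hv).
  assert (Hpi := PI_RGT_0).
  set (G := fun z => g (p + v * cexp z)%C).
  assert (HG : forall x y, x <= s -> exists l, cder G (x, y) l).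
  { intros x y Hx.
    assert (Hc : Cmod (v * cexp (x, y))%C = Cmod v * exp x) by (rewrite Cmod_mult, Cmod_cexp; reflexivity).
    assert (He := exp_pos x).
    destruct (Hder (p + v * cexp (x, y))%C) as [l Hl].
    - intros E. assert (E' : (v * cexp (x, y) = 0)%C).
      { replace (v * cexp (x, y))%C with (p + v * cexp (x, y) - p)%C by ring. rewrite E. ring. }
      rewrite E', Cmod_0 in Hc. nra.
    - replace (p + v * cexp (x, y) - p)%C with (v * cexp (x, y))%C by ring. rewrite Hc.
      apply Rle_lt_trans with (2 := Hs). apply Rmult_le_compat_l; [lra|].
      destruct Hx as [Hx| ->]; [left; apply exp_increasing, Hx|right; reflexivity].
    - eexists. unfold G. apply cder_comp with (f := g); [exact Hl|].
      apply cder_plus; [apply cder_const|].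
      apply cder_mult; [apply cder_const|apply cder_cexp]. }
  set (I := fun x => RInt (fun t => Re (G (x, t))) 0 (2 * PI)).
  assert (HI : forall x, x <= s -> I x = I s).
  { intros x Hx.
    assert (E := goursat_rectangle G x s 0 (2 * PI) Hx ltac:(lra)
      (fun a b Ha _ => HG a b (proj2 Ha))).
    assert (E' : forall u, G (u, 2 * PI) = G (u, 0)).
    { intros u. unfold G, cexp; simpl. rewrite cos_2PI, sin_2PI, cos_0, sin_0. reflexivity. }
    rewrite (RInt_ext (fun u => Im (G (u, 2 * PI))) (fun u => Im (G (u, 0)))) in E
      by (intros; rewrite E'; reflexivity).
    unfold I. lra. }
  change (I s = 2 * PI * Re (g p)).
  apply NNPP. intros Hne. apply Rminus_eq_contra, Rabs_pos_lt in Hne.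
  (* Integrated over length 2 pi, this tolerance is half of the supposed discrepancy. *)
  destruct (Hcont (Rabs (I s - 2 * PI * Re (g p)) / (4 * PI))) as (d & Hd & Hd').
  { apply Rdiv_lt_0_compat; lra. }
  (* Far enough to the left that the circle of radius |v| exp x, at most d / 2, lies where [g] is
     close to [g p]. *)
  set (x := Rmin s (ln (d / (2 * Cmod v)))).
  assert (Hx : Cmod v * exp x < d).
  { apply Rle_lt_trans with (Cmod v * (d / (2 * Cmod v))).
    - apply Rmult_le_compat_l; [lra|].
      rewrite <- (exp_ln (d / (2 * Cmod v))) by (apply Rdiv_lt_0_compat; lra).
      destruct (Rmin_r s (ln (d / (2 * Cmod v)))) as [H|H]; fold x in H.
      + left; apply exp_increasing, H.
      + rewrite H; right; reflexivity.
    - replace (Cmod v * (d / (2 * Cmod v))) with (d / 2) by (field; lra). lra. }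
  assert (Hxs : x <= s) by apply Rmin_l.
  assert (B : Rabs (I x - (2 * PI - 0) * Re (g p)) <=
    (2 * PI - 0) * (Rabs (I s - 2 * PI * Re (g p)) / (4 * PI))).
  { apply RInt_near_const; [lra| |].
    - apply (ex_RInt_continuous (V := R_CompleteNormedModule)). intros t _.
      destruct (HG x t Hxs) as [l Hl]. apply (continuous_vertical G x t), (cder_ccont _ _ _ Hl).
    - intros t _. left. unfold Rminus. rewrite <- re_opp, <- re_plus.
      apply Rle_lt_trans with (1 := re_le_Cmod _). apply Hd'.
      replace (p + v * cexp (x, t) - p)%C with (v * cexp (x, t))%C by ring.
      rewrite Cmod_mult, Cmod_cexp. exact Hx. }
  rewrite (HI x Hxs), Rminus_0_r in B.
  replace (2 * PI * (Rabs (I s - 2 * PI * Re (g p)) / (4 * PI)))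
    with (Rabs (I s - 2 * PI * Re (g p)) / 2) in B by (field; lra).
  lra.
Qed.

Lemma RInt_nonneg_eq_0 (f : R -> R) (a b t : R) : a < t < b ->
  (forall x, continuous f x) -> (forall x, 0 <= f x) -> RInt f a b = 0 -> f t = 0.
Proof.
  intros Ht Hc Hp H0. destruct (Hp t) as [Hlt|]; [|auto]. exfalso.
  assert (Hex : forall x y, ex_RInt f x y)
    by (intros x y; apply (ex_RInt_continuous (V := R_CompleteNormedModule)); intros; apply Hc).
  destruct (proj1 (filterlim_locally f (f t)) (Hc t) (mkposreal _ Hlt)) as [d Hd].
  set (u := Rmax a (t - d)). set (w := Rmin b (t + d)).
  assert (Hd0 := cond_pos d).
  assert (Hu : a <= u < t) by (split; [apply Rmax_l|apply Rmax_lub_lt; lra]).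
  assert (Hw : t < w <= b) by (split; [apply Rmin_glb_lt; lra|apply Rmin_l]).
  assert (Hu' : t - d <= u) by apply Rmax_r. assert (Hw' : w <= t + d) by apply Rmin_r.
  assert (P : 0 < RInt f u w).
  { apply RInt_gt_0; [lra| |intros; apply Hc].
    intros x Hx. specialize (Hd x). simpl in Hd.
    assert (B : Rabs (f x - f t) < f t) by (apply Hd; change (Rabs (x - t) < d); apply Rabs_lt_between; lra).
    apply Rabs_lt_between in B. lra. }
  assert (P1 : 0 <= RInt f a u) by (apply RInt_ge_0; [lra|apply Hex|intros; apply Hp]).
  assert (P2 : 0 <= RInt f w b) by (apply RInt_ge_0; [lra|apply Hex|intros; apply Hp]).
  assert (E1 := RInt_Chasles (V := R_CompleteNormedModule) f a u w (Hex _ _) (Hex _ _)).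
  assert (E2 := RInt_Chasles (V := R_CompleteNormedModule) f a w b (Hex _ _) (Hex _ _)).
  unfold plus in E1, E2; simpl in E1, E2. lra.
Qed.

Lemma cexp_imaginary_pi : cexp (0, PI) = (- (1))%C.
Proof.
  unfold cexp, Copp, RtoC; simpl. rewrite exp_0, cos_PI, sin_PI. f_equal; ring.
Qed.

(** On the circle through [w] the nonnegative function [Re (g p) - Re g] has mean 0, so it vanishes
    there. *)
Lemma re_max_local (g : C -> C) (p : C) (r : R) :
  ccont g p ->
  (forall w, w <> p -> Cmod (w - p)%C < r -> exists l, cder g w l) ->
  (forall w, Cmod (w - p)%C < r -> Re (g w) <= Re (g p)) ->
  forall w, Cmod (w - p)%C < r -> Re (g w) = Re (g p).
Proof.
  intros Hc Hd Hmax w Hw.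
  destruct (Ceq_dec w p) as [->|Hne]; [reflexivity|].
  (* The opposite direction is taken so that [w] sits at angle pi, interior to the interval from 0
     to 2 pi, as [RInt_nonneg_eq_0] demands. *)
  set (v := (p - w)%C).
  assert (Hv : v <> 0%C) by (apply Cminus_eq_contra; congruence).
  assert (Hvm : Cmod v = Cmod (w - p)%C) by (rewrite <- Cmod_opp; f_equal; unfold v; ring).
  assert (Hball : forall t, Cmod (p + v * cexp (0, t) - p)%C < r).
  { intros t. replace (p + v * cexp (0, t) - p)%C with (v * cexp (0, t))%C by ring.
    rewrite Cmod_mult, Cmod_cexp. simpl. rewrite exp_0. lra. }
  assert (Hneq : forall t, (p + v * cexp (0, t))%C <> p).
  { intros t E. assert (E' : (v * cexp (0, t) = 0)%C).
    { replace (v * cexp (0, t))%C with (p + v * cexp (0, t) - p)%C by ring. rewrite E. ring. }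
    apply (f_equal Cmod) in E'. rewrite Cmod_mult, Cmod_cexp, Cmod_0 in E'. simpl in E'.
    rewrite exp_0, Rmult_1_r in E'. apply Cmod_eq_0 in E'. contradiction. }
  assert (Hcont : forall t, continuous (fun t => Re (g (p + v * cexp (0, t))%C)) t).
  { intros t. destruct (Hd _ (Hneq t) (Hball t)) as [l Hl].
    apply (continuous_vertical (fun z => g (p + v * cexp z)%C) 0 t).
    eapply cder_ccont. apply cder_comp with (f := g); [exact Hl|].
    apply cder_plus; [apply cder_const|].
    apply cder_mult; [apply cder_const|apply cder_cexp]. }
  assert (E : Re (g p) - Re (g (p + v * cexp (0, PI))%C) = 0).
  { assert (Hpi := PI_RGT_0).
    apply (RInt_nonneg_eq_0 (fun t => Re (g p) - Re (g (p + v * cexp (0, t))%C)) 0 (2 * PI)).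
    - lra.
    - intros x. apply (continuous_minus (V := R_NormedModule)); [apply continuous_const|apply Hcont].
    - intros x. specialize (Hmax _ (Hball x)). lra.
    - assert (E := RInt_minus (V := R_CompleteNormedModule) (fun _ => Re (g p))
        (fun t => Re (g (p + v * cexp (0, t))%C)) 0 (2 * PI) (ex_RInt_const _ _ _)
        (ex_RInt_continuous (V := R_CompleteNormedModule) _ _ _ (fun t _ => Hcont t))).
      rewrite RInt_const in E.
      rewrite (mean_value_property g p v r 0 Hv Hc Hd) in E by (rewrite exp_0; lra).
      refine (eq_trans E _). unfold minus, plus, opp, scal; simpl. unfold mult; simpl. ring. }
  rewrite cexp_imaginary_pi in E. replace (p + v * - (1))%C with w in E by (unfold v; ring). lra.
Qed.

Lemma Cmod_sqr (z : C) : Cmod z * Cmod z = Re z * Re z + Im z * Im z.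
Proof. assert (E := Cmod2_alt z). simpl in E. lra. Qed.

(** Multiplying by [Cconj (g p)] makes the value at [p] real and nonnegative, so the maximum of the
    modulus becomes a maximum of the real part. Expanding |g w - g p|^2 with |g w| <= |g p| then
    leaves at most 0. *)
Lemma Cmod_max_local (g : C -> C) (p : C) (r : R) :
  ccont g p ->
  (forall w, w <> p -> Cmod (w - p)%C < r -> exists l, cder g w l) ->
  (forall w, Cmod (w - p)%C < r -> Cmod (g w) <= Cmod (g p)) ->
  forall w, Cmod (w - p)%C < r -> g w = g p.
Proof.
  intros Hc Hd Hmax w Hw.
  assert (Ere : forall z, Re (Cconj (g p) * z)%C = Re (g p) * Re z + Im (g p) * Im z).
  { intros z. rewrite re_mult, re_conj, im_conj. ring. }
  assert (E : Re (Cconj (g p) * g w)%C = Re (Cconj (g p) * g p)%C).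
  { apply (re_max_local (fun z => Cconj (g p) * g z)%C p r); [| | |exact Hw].
    - intros eps Heps. assert (Hm := Cmod_ge_0 (g p)).
      destruct (Hc (eps / (1 + Cmod (g p)))) as (d & Hd0 & Hd').
      { apply Rdiv_lt_0_compat; lra. }
      exists d; split; [exact Hd0|]. intros z Hz. specialize (Hd' z Hz).
      replace (Cconj (g p) * g z - Cconj (g p) * g p)%C with (Cconj (g p) * (g z - g p))%C by ring.
      rewrite Cmod_mult, Cmod_conj.
      apply Rmult_lt_compat_r with (r := 1 + Cmod (g p)) in Hd'; [|lra].
      replace (eps / (1 + Cmod (g p)) * (1 + Cmod (g p))) with eps in Hd' by (field; lra).
      assert (Hz' := Cmod_ge_0 (g z - g p)%C). nra.
    - intros z Hz Hz'. destruct (Hd z Hz Hz') as [l Hl]. eexists.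
      apply cder_mult; [apply cder_const|exact Hl].
    - intros z Hz. apply Rle_trans with (1 := Rle_abs _).
      apply Rle_trans with (1 := re_le_Cmod _). rewrite Cmod_mult, Cmod_conj, Ere.
      rewrite <- Cmod_sqr. apply Rmult_le_compat_l; [apply Cmod_ge_0|apply Hmax, Hz]. }
  rewrite !Ere in E.
  assert (H1 := Cmod_sqr (g w)). assert (H2 := Cmod_sqr (g p)).
  assert (H3 := Hmax w Hw). assert (H4 := Cmod_ge_0 (g w)).
  apply Ceq_minus, Cmod_eq_0. assert (H5 := Cmod_ge_0 (g w - g p)%C).
  assert (H6 := Cmod_sqr (g w - g p)%C). unfold Cminus in *.
  rewrite re_plus, im_plus, re_opp, im_opp in H6.
  assert (Cmod (g w) * Cmod (g w) <= Cmod (g p) * Cmod (g p)) by (apply Rmult_le_compat; lra).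
  nra.
Qed.

Lemma segment_in_disk (z0 z1 : C) (r t : R) : Cmod z0 < r -> Cmod z1 < r -> 0 <= t <= 1 ->
  Cmod (z0 + t * (z1 - z0))%C < r.
Proof.
  intros H0 H1 Ht.
  replace (z0 + t * (z1 - z0))%C with ((1 - t)%R * z0 + t * z1)%C by (rewrite RtoC_minus; ring).
  apply Rle_lt_trans with (1 := Cmod_triangle _ _).
  rewrite !Cmod_mult, !Cmod_R, !Rabs_pos_eq by lra.
  assert (A0 := Cmod_ge_0 z0). assert (A1 := Cmod_ge_0 z1).
  destruct (Req_dec t 0) as [->|Hne]; [lra|].
  assert (t * Cmod z1 < t * r) by (apply Rmult_lt_compat_l; lra).
  assert ((1 - t) * Cmod z0 <= (1 - t) * r) by (apply Rmult_le_compat_l; lra).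
  lra.
Qed.

(** The local principle is propagated along the segment from [z0] to the target: the supremum [tau]
    of the parameters up to which [g] is constant is itself good by continuity, and [Hloc] extends
    past it unless it is 1. *)
Lemma strong_max_principle (g : C -> C) (r : R) (z0 : C) :
  (forall z, Cmod z < r -> ccont g z) ->
  (forall z : C, z <> 0%C -> Cmod z < r -> exists l, cder g z l) ->
  (forall z, Cmod z < r -> Cmod (g z) <= Cmod (g z0)) -> Cmod z0 < r ->
  forall z, Cmod z < r -> g z = g z0.
Proof.
  intros Hc Hd Hmax Hz0 z1 Hz1.
  assert (Hloc : forall p, Cmod p < r -> g p = g z0 -> exists e, 0 < e /\
    forall w, Cmod (w - p)%C < e -> g w = g z0).
  { intros p Hp Ep.
    assert (Hball : forall w, Cmod (w - p)%C < r - Cmod p -> Cmod w < r).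
    { intros w Hw. replace w with ((w - p) + p)%C by ring.
      apply Rle_lt_trans with (1 := Cmod_triangle _ _). lra. }
    (* [g] may fail to be differentiable at 0, so a disk about any other centre has to leave out 0,
       while at 0 itself continuity suffices. *)
    exists (if Ceq_dec p 0 then r else Rmin (r - Cmod p) (Cmod p)).
    destruct (Ceq_dec p 0) as [->|Hp0].
    - split; [apply Rle_lt_trans with (2 := Hp), Cmod_ge_0|].
      rewrite <- Ep. rewrite <- Ep in Hmax. rewrite Cmod_0, Rminus_0_r in Hball.
      apply Cmod_max_local; [apply Hc, Hp| |]; intros w; auto.
    - assert (Hp1 : 0 < Cmod p) by (apply Cmod_gt_0, Hp0).
      split; [apply Rmin_pos; lra|].
      rewrite <- Ep. rewrite <- Ep in Hmax.
      apply Cmod_max_local; [apply Hc, Hp| |].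
      + intros w _ Hw. apply Hd.
        * intros ->. assert (H := Rlt_le_trans _ _ _ Hw (Rmin_r _ _)).
          rewrite <- Cmod_opp in H. replace (- (0 - p))%C with p in H by ring. lra.
        * apply Hball, (Rlt_le_trans _ _ _ Hw (Rmin_l _ _)).
      + intros w Hw. apply Hmax, Hball, (Rlt_le_trans _ _ _ Hw (Rmin_l _ _)). }
  set (p := fun t : R => (z0 + t * (z1 - z0))%C).
  set (L := 1 + Cmod (z1 - z0)%C).
  assert (HL : 0 < L) by (assert (H := Cmod_ge_0 (z1 - z0)%C); unfold L; lra).
  assert (Hlip : forall t s e, Rabs (t - s) < e / L -> Cmod (p t - p s)%C < e).
  { intros t s e H. unfold p.
    replace (z0 + t * (z1 - z0) - (z0 + s * (z1 - z0)))%C with ((t - s)%R * (z1 - z0))%C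
      by (rewrite RtoC_minus; ring).
    rewrite Cmod_mult, Cmod_R. apply Rmult_lt_compat_r with (r := L) in H; [|exact HL].
    replace (e / L * L) with e in H by (field; lra).
    assert (H1 := Rabs_pos (t - s)). unfold L in H. nra. }
  set (E := fun t => 0 <= t <= 1 /\ forall s, 0 <= s <= t -> g (p s) = g z0).
  assert (E0 : E 0).
  { split; [lra|]. intros s Hs. replace s with 0 by lra. f_equal. unfold p. ring. }
  destruct (completeness E) as [tau [Hub Hlub]].
  { exists 1. intros t [Ht _]. lra. }
  { exists 0. exact E0. }
  assert (Htau : 0 <= tau <= 1).
  { split; [apply Hub, E0|apply Hlub; intros t [Ht _]; lra]. }
  assert (Hbelow : forall s, 0 <= s < tau -> g (p s) = g z0).
  { intros s Hs. apply NNPP. intros Hn.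
    assert (tau <= s); [|lra]. apply Hlub. intros t [Ht Ht'].
    destruct (Rle_lt_dec t s) as [|Hlt]; [assumption|]. exfalso. apply Hn, Ht'. lra. }
  assert (Hin : forall t, 0 <= t <= 1 -> Cmod (p t) < r).
  { intros t Ht. apply segment_in_disk; assumption. }
  assert (Hat : g (p tau) = g z0).
  { destruct (Req_dec tau 0) as [->|Htau0]; [apply E0; lra|].
    apply NNPP. intros Hn. apply Cminus_eq_contra, Cmod_gt_0 in Hn.
    destruct (Hc (p tau) (Hin tau Htau) _ Hn) as (d & Hd0 & Hd').
    assert (HdL : 0 < d / L) by (apply Rdiv_lt_0_compat; lra).
    set (s := Rmax 0 (tau - d / L / 2)).
    assert (Hs1 := Rmax_l 0 (tau - d / L / 2)). assert (Hs2 := Rmax_r 0 (tau - d / L / 2)).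
    assert (Hs3 : s < tau) by (apply Rmax_lub_lt; lra). fold s in Hs1, Hs2.
    assert (H := Hd' (p s) ltac:(apply Hlip, Rabs_lt_between; lra)).
    rewrite Hbelow, <- Cmod_opp in H by lra.
    replace (- (g z0 - g (p tau)))%C with (g (p tau) - g z0)%C in H by ring. lra. }
  destruct (Hloc (p tau) (Hin tau Htau) Hat) as (e & He & He').
  assert (HeL : 0 < e / L) by (apply Rdiv_lt_0_compat; lra).
  set (t1 := Rmin 1 (tau + e / L / 2)).
  assert (Ht1 := Rmin_l 1 (tau + e / L / 2)). assert (Ht2 := Rmin_r 1 (tau + e / L / 2)).
  fold t1 in Ht1, Ht2.
  assert (Ht3 : tau <= t1) by (apply Rmin_glb; lra).
  assert (HE : E t1).
  { split; [lra|]. intros s Hs. destruct (Rlt_le_dec s tau) as [Hlt|Hge].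
    - apply Hbelow; lra.
    - apply He', Hlip, Rabs_lt_between. lra. }
  assert (t1 <= tau) by (apply Hub, HE).
  assert (Htau1 : t1 = 1).
  { unfold t1 in *. destruct (Rle_lt_dec 1 (tau + e / L / 2)) as [Hle|Hlt].
    - apply Rmin_left, Hle.
    - rewrite Rmin_right in * by lra. lra. }
  rewrite Htau1 in HE. replace z1 with (p 1); [apply HE; lra|unfold p; ring].
Qed.

(* Used with [Q] trivial (boundedness) and with [Q x := x < S] (attainment of the supremum [S]). *)
Lemma disk_bound (phi : C -> R) (Q : R -> Prop) (r : R) :
  (forall x y, Q x -> Q y -> Q (Rmax x y)) -> (exists B, Q B) ->
  (forall z, Cmod z <= r -> exists B d, Q B /\ 0 < d /\
     forall w, Cmod w <= r -> Cmod (w - z)%C < d -> phi w <= B) ->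
  exists B, Q B /\ forall z, Cmod z <= r -> phi z <= B.
Proof.
  intros Hmax [B0 HB0] Hloc.
  destruct (Rlt_le_dec r 0) as [Hr|Hr].
  { exists B0; split; [exact HB0|]. intros z Hz. assert (H := Cmod_ge_0 z). lra. }
  enough (H : exists B, Q B /\ forall x y, - r <= x <= r -> - r <= y <= r ->
                Cmod (x, y) <= r -> phi (x, y) <= B).
  { destruct H as (B & HB & H). exists B; split; [exact HB|]. intros [x y] Hz.
    assert (Hx := re_le_Cmod (x, y)). assert (Hy := im_le_Cmod (x, y)). simpl in Hx, Hy.
    apply H; [| |exact Hz]; apply Rabs_le_between; lra. }
  apply (rectangle_bisection (fun a b c d => exists B, Q B /\
    forall x y, a <= x <= b -> c <= y <= d -> Cmod (x, y) <= r -> phi (x, y) <= B)); [lra|lra| |].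
  - intros a b c d _ _ _ _ (B1 & Q1 & H1) (B2 & Q2 & H2) (B3 & Q3 & H3) (B4 & Q4 & H4).
    exists (Rmax (Rmax B1 B2) (Rmax B3 B4)); split; [auto|].
    assert (R1 := Rmax_l (Rmax B1 B2) (Rmax B3 B4)). assert (R2 := Rmax_r (Rmax B1 B2) (Rmax B3 B4)).
    assert (R3 := Rmax_l B1 B2). assert (R4 := Rmax_r B1 B2).
    assert (R5 := Rmax_l B3 B4). assert (R6 := Rmax_r B3 B4).
    intros x y Hx Hy Hxy.
    destruct (Rle_lt_dec x ((a + b) / 2)); destruct (Rle_lt_dec y ((c + d) / 2)).
    + specialize (H1 x y ltac:(lra) ltac:(lra) Hxy). lra.
    + specialize (H3 x y ltac:(lra) ltac:(lra) Hxy). lra.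
    + specialize (H2 x y ltac:(lra) ltac:(lra) Hxy). lra.
    + specialize (H4 x y ltac:(lra) ltac:(lra) Hxy). lra.
  - intros x y _ _.
    assert (HB : exists B d, Q B /\ 0 < d /\
      forall w, Cmod w <= r -> Cmod (w - (x, y))%C < d -> phi w <= B).
    { destruct (Rle_lt_dec (Cmod (x, y)) r) as [Hle|Hgt]; [apply Hloc, Hle|].
      (* A point of the square outside the disk has a neighbourhood free of disk points, where any
         bound satisfying [Q] will do. *)
      exists B0, (Cmod (x, y) - r). repeat split; [exact HB0|lra|].
      intros w Hw1 Hw2. exfalso. assert (T := Cmod_triangle w (- (w - (x, y)))%C).
      assert (E : forall z : C, (w + - (w - z))%C = z) by (intros z; ring).
      rewrite Cmod_opp, E in T. lra. }
    destruct HB as (B & d & HQ & Hd & H).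
    exists (d / 2); split; [lra|]. intros a' b' c' d' Ha Hb Hc Hd' Hw Hh.
    exists B; split; [exact HQ|]. intros u v Hu Hv Huv. apply H; [exact Huv|].
    unfold Cminus, Cplus, Copp; simpl.
    apply Rle_lt_trans with (1 := Cmod_pair_le _ _).
    assert (Rabs (u + - x) <= b' - a') by (apply Rabs_le; lra).
    assert (Rabs (v + - y) <= d' - c') by (apply Rabs_le; lra). lra.
Qed.

(** Local boundedness gives a supremum [S]. Were it not attained, |g| would be locally bounded by
    numbers below [S], hence globally by one such number. *)
Lemma Cmod_max_attained (g : C -> C) (r : R) : 0 <= r ->
  (forall z, Cmod z <= r -> ccont g z) ->
  exists p, Cmod p <= r /\ forall z, Cmod z <= r -> Cmod (g z) <= Cmod (g p).
Proof.
  intros Hr Hc.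
  assert (Hnear : forall z e, Cmod z <= r -> 0 < e -> exists d, 0 < d /\
    forall w, Cmod (w - z)%C < d -> Cmod (g w) <= Cmod (g z) + e).
  { intros z e Hz He. destruct (Hc z Hz e He) as (d & Hd & H). exists d; split; [exact Hd|].
    intros w Hw. specialize (H w Hw). replace (g w) with (g z + (g w - g z))%C by ring.
    assert (T := Cmod_triangle (g z) (g w - g z)%C). lra. }
  destruct (disk_bound (fun z => Cmod (g z)) (fun _ => True) r) as (B & _ & HB); auto.
  { exists 0. exact I. }
  { intros z Hz. destruct (Hnear z 1 Hz Rlt_0_1) as (d & Hd & H).
    exists (Cmod (g z) + 1), d. repeat split; auto. }
  destruct (completeness (fun y => exists z, Cmod z <= r /\ y = Cmod (g z))) as [S [HS1 HS2]].
  { exists B. intros y (z & Hz & ->). apply HB, Hz. }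
  { exists (Cmod (g 0)), 0%C. rewrite Cmod_0. auto. }
  apply NNPP. intros Hn.
  assert (Hlt : forall z, Cmod z <= r -> Cmod (g z) < S).
  { intros z Hz. destruct (HS1 (Cmod (g z))) as [H|H]; [exists z; auto|exact H|].
    exfalso. apply Hn. exists z; split; [exact Hz|]. intros w Hw. rewrite H. apply HS1. exists w; auto. }
  destruct (disk_bound (fun z => Cmod (g z)) (fun x => x < S) r) as (B' & HB'1 & HB'2).
  { intros x y Hx Hy. apply Rmax_lub_lt; assumption. }
  { exists (S - 1). lra. }
  { intros z Hz. specialize (Hlt z Hz).
    destruct (Hnear z ((S - Cmod (g z)) / 2) Hz ltac:(lra)) as (d & Hd & H).
    exists (Cmod (g z) + (S - Cmod (g z)) / 2), d. repeat split; auto; lra. }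
  assert (S <= B'); [|lra]. apply HS2. intros y (z & Hz & ->). apply HB'2, Hz.
Qed.

(** * Schwarz's lemma *)

(** The value at 0 is the derivative of [h] there, which makes the quotient continuous; whether it
    is differentiable at 0 is left open, and the maximum principle above does not ask. *)
Lemma schwarz_quotient (h : C -> C) :
  (forall z, in_disk z -> exists l, cder h z l) -> h 0%C = 0%C ->
  exists g : C -> C,
    (forall z, in_disk z -> h z = (g z * z)%C) /\
    (forall z, in_disk z -> ccont g z) /\
    (forall z : C, z <> 0%C -> in_disk z -> exists l, cder g z l).
Proof.
  intros Hd H0. unfold in_disk in *.
  destruct (Hd 0%C) as [l Hl]; [rewrite Cmod_0; lra|].
  set (g := fun z : C => if Ceq_dec z 0 then l else (h z / z)%C).
  assert (Hder : forall z : C, z <> 0%C -> Cmod z < 1 -> exists l, cder g z l).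
  { intros z Hz Hz1. destruct (Hd z Hz1) as [k Hk].
    destruct (cder_div h (fun w => w) z k 1 Hz Hk (cder_id z)) as [m Hm].
    exists m. apply cder_ext_ball with (f := fun w => (h w / w)%C) (r := Cmod z); [apply Cmod_gt_0, Hz| |exact Hm].
    intros w Hw. unfold g. destruct (Ceq_dec w 0) as [->|]; [|reflexivity].
    exfalso. rewrite <- Cmod_opp in Hw. replace (- (0 - z))%C with z in Hw by ring. lra. }
  exists g. repeat split; [| |exact Hder].
  - intros z _. unfold g. destruct (Ceq_dec z 0) as [->|Hz]; [rewrite H0; ring|field; exact Hz].
  - intros z Hz. destruct (Ceq_dec z 0) as [->|Hz0].
    + intros eps Heps. destruct (proj1 (cder_eps _ _ _) Hl (eps / 2)) as (d & Hd0 & H); [lra|].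
      exists d; split; [exact Hd0|]. intros w Hw. specialize (H w Hw).
      rewrite H0 in H. replace (w - 0)%C with w in * by ring.
      unfold g. destruct (Ceq_dec 0 0) as [_|]; [|congruence].
      destruct (Ceq_dec w 0) as [->|Hw0].
      { replace (l - l)%C with (RtoC 0) by ring. rewrite Cmod_0. exact Heps. }
      assert (Hw1 : 0 < Cmod w) by (apply Cmod_gt_0, Hw0).
      replace (h w - 0 - l * w)%C with ((h w / w - l) * w)%C in H by (field; exact Hw0).
      rewrite Cmod_mult in H. apply Rmult_le_reg_r in H; lra.
    + destruct (Hder z Hz0 Hz) as [k Hk]. apply (cder_ccont _ _ _ Hk).
Qed.

(** A maximum of |g| exists only on closed disks, so |g| <= 1/r is proved for |z| <= r and then r is
    pushed to 1. *)
Lemma schwarz_lemma (h : C -> C) :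
  (forall z, in_disk z -> exists l, cder h z l) -> h 0%C = 0%C ->
  (forall z, in_disk z -> Cmod (h z) <= 1) ->
  (forall z, in_disk z -> Cmod (h z) <= Cmod z) /\
  (forall z0, in_disk z0 -> z0 <> 0%C -> Cmod (h z0) = Cmod z0 ->
     exists c, Cmod c = 1 /\ forall z, in_disk z -> h z = (c * z)%C).
Proof.
  intros Hd H0 H1.
  destruct (schwarz_quotient h Hd H0) as (g & Hg & Hgc & Hgd). unfold in_disk in *.
  assert (Hr : forall r, 0 < r < 1 -> forall z, Cmod z <= r -> Cmod (g z) <= / r).
  { intros r Hr.
    destruct (Cmod_max_attained g r) as (p & Hp & Hmax).
    { lra. }
    { intros z Hz. apply Hgc. lra. }
    enough (Hgp : Cmod (g p) <= / r).
    { intros z Hz. apply Rle_trans with (2 := Hgp), Hmax, Hz. }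
    assert (Hmul : forall z, Cmod z < 1 -> Cmod (g z) * Cmod z <= 1).
    { intros z Hz. rewrite <- Cmod_mult, <- Hg by exact Hz. apply H1, Hz. }
    (* A maximum on the circle |p| = r is bounded directly by [Hmul]. An interior one makes [g]
       constant on the open disk, and [Hmul] is applied at a point close to the circle instead. *)
    destruct Hp as [Hp|Hp].
    - assert (Hconst := strong_max_principle g r p (fun z Hz => Hgc z (Rlt_trans _ _ _ Hz (proj2 Hr)))
        (fun z Hz Hz' => Hgd z Hz (Rlt_trans _ _ _ Hz' (proj2 Hr)))
        (fun z Hz => Hmax z (Rlt_le _ _ Hz)) Hp).
      apply Rnot_lt_le. intros Hlt.
      assert (Hinv : 0 < / r) by (apply Rinv_0_lt_compat; lra).
      assert (Hgr : / Cmod (g p) < r).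
      { rewrite <- (Rinv_inv r). apply Rinv_lt_contravar; [nra|exact Hlt]. }
      assert (Hpos : 0 < / Cmod (g p)) by (apply Rinv_0_lt_compat; lra).
      (* Strictly between 1/|g p| and r: [t] lies in the open disk, yet |g p| t > 1. *)
      set (t := (/ Cmod (g p) + r) / 2).
      assert (Ht : Cmod t = t) by (rewrite Cmod_R; apply Rabs_pos_eq; unfold t; lra).
      assert (Ht2 : Cmod t < r) by (rewrite Ht; unfold t; lra).
      assert (B := Hmul t ltac:(lra)). rewrite (Hconst t Ht2), Ht in B.
      assert (Cmod (g p) * / Cmod (g p) = 1) by (field; lra).
      assert (Cmod (g p) * / Cmod (g p) < Cmod (g p) * t) by (apply Rmult_lt_compat_l; unfold t; lra).
      lra.
    - assert (B := Hmul p ltac:(lra)). rewrite Hp in B.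
      apply Rmult_le_reg_r with r; [lra|]. rewrite Rinv_l by lra. exact B. }
  assert (Hg1 : forall z, Cmod z < 1 -> Cmod (g z) <= 1).
  { intros z Hz. apply Rnot_lt_le. intros Hlt.
    assert (Hi : / Cmod (g z) < 1) by (rewrite <- Rinv_1; apply Rinv_lt_contravar; lra).
    assert (Hpos : 0 < / Cmod (g z)) by (apply Rinv_0_lt_compat; lra).
    (* A radius between [m] and 1 contains [z] but has inverse below |g z|, against [Hr]. *)
    set (m := Rmax (Cmod z) (/ Cmod (g z))).
    assert (Hm1 := Rmax_l (Cmod z) (/ Cmod (g z))). assert (Hm2 := Rmax_r (Cmod z) (/ Cmod (g z))).
    assert (Hm3 : m < 1) by (apply Rmax_lub_lt; lra). fold m in Hm1, Hm2.
    assert (B := Hr ((m + 1) / 2) ltac:(lra) z ltac:(lra)).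
    assert (/ ((m + 1) / 2) < Cmod (g z)); [|lra].
    rewrite <- (Rinv_inv (Cmod (g z))). apply Rinv_lt_contravar; [|lra].
    apply Rmult_lt_0_compat; lra. }
  split.
  - intros z Hz. rewrite Hg, Cmod_mult by exact Hz.
    rewrite <- (Rmult_1_l (Cmod z)) at 2.
    apply Rmult_le_compat_r; [apply Cmod_ge_0|apply Hg1, Hz].
  - intros z0 Hz0 Hne E. exists (g z0).
    assert (Hpos : 0 < Cmod z0) by (apply Cmod_gt_0, Hne).
    assert (E1 : Cmod (g z0) = 1).
    { rewrite Hg, Cmod_mult in E by exact Hz0. apply Rmult_eq_reg_r with (Cmod z0); lra. }
    split; [exact E1|]. intros z Hz. rewrite Hg by exact Hz. f_equal.
    apply (strong_max_principle g 1); auto. rewrite E1. exact Hg1.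
Qed.

(** * Rigidity *)

Lemma cder_line (f : C -> C) (p v l : C) (t : R) : cder f (p + t * v)%C l ->
  is_derive (fun s : R => Re (f (p + s * v)%C)) t (Re (l * v)%C) /\
  is_derive (fun s : R => Im (f (p + s * v)%C)) t (Im (l * v)%C).
Proof.
  intros H.
  assert (K : forall eps, 0 < eps -> exists d : posreal, forall h, h <> 0 -> Rabs h < d ->
    Cmod (f (p + (t + h)%R * v) - f (p + t * v) - h * (l * v))%C < eps * Rabs h).
  { intros eps Heps. assert (Hv := Cmod_ge_0 v).
    assert (He : 0 < eps / (1 + Cmod v)) by (apply Rdiv_lt_0_compat; lra).
    destruct (proj1 (cder_eps _ _ _) H _ He) as (d & Hd & Hd').
    assert (Hp : 0 < d / (1 + Cmod v)) by (apply Rdiv_lt_0_compat; lra).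
    exists (mkposreal _ Hp). simpl. intros h Hh0 Hh.
    assert (Hh1 := Rabs_pos_lt h Hh0).
    assert (E : Cmod (p + (t + h)%R * v - (p + t * v))%C = Rabs h * Cmod v).
    { rewrite <- Cmod_R, <- Cmod_mult. f_equal. rewrite RtoC_plus. ring. }
    assert (B : Rabs h * Cmod v < d).
    { apply Rmult_lt_compat_r with (r := 1 + Cmod v) in Hh; [|lra].
      replace (d / (1 + Cmod v) * (1 + Cmod v)) with d in Hh by (field; lra). lra. }
    assert (B' := Hd' (p + (t + h)%R * v)%C ltac:(rewrite E; exact B)). rewrite E in B'.
    replace (h * (l * v))%C with (l * (p + (t + h)%R * v - (p + t * v)))%C
      by (rewrite RtoC_plus; ring).
    apply Rle_lt_trans with (1 := B').
    replace (eps * Rabs h) with (eps / (1 + Cmod v) * (Rabs h * (1 + Cmod v))) by (field; lra).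
    apply Rmult_lt_compat_l; lra. }
  assert (Hdiv : forall a h e, h <> 0 -> Rabs (a * h) < e * Rabs h -> Rabs a < e).
  { intros a h e Hh. rewrite Rabs_mult. apply Rmult_lt_reg_r, Rabs_pos_lt, Hh. }
  split; apply is_derive_Reals; intros eps Heps; destruct (K eps Heps) as [d Hd];
    exists d; intros h Hh0 Hh; specialize (Hd h Hh0 Hh); apply (Hdiv _ h); try exact Hh0.
  - apply Rle_lt_trans with (2 := Hd). apply Rle_trans with (2 := re_le_Cmod _).
    unfold Cminus. rewrite !re_plus, !re_opp, re_scal_l. right; f_equal; field; exact Hh0.
  - apply Rle_lt_trans with (2 := Hd). apply Rle_trans with (2 := im_le_Cmod _).
    unfold Cminus. rewrite !im_plus, !im_opp, im_scal_l. right; f_equal; field; exact Hh0.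
Qed.

(** The mean value theorem stands in for the fundamental theorem of calculus, so the derivative is
    known only pointwise. *)
Lemma is_derive_const_increment (F : R -> R) (k : R) :
  (forall t, 0 <= t <= 1 -> is_derive F t k) -> F 1 = F 0 + k.
Proof.
  intros H. destruct (MVT_gen F 0 1 (fun _ => k)) as (c & _ & E).
  - rewrite Rmin_left, Rmax_right by lra. intros x Hx. apply H. lra.
  - rewrite Rmin_left, Rmax_right by lra. intros x Hx.
    apply derivable_continuous_pt. exists k. apply is_derive_Reals, H, Hx.
  - lra.
Qed.

Lemma cder_segment (f : C -> C) (p v : C) (k : R) :
  ((forall t, 0 <= t <= 1 -> exists l, cder f (p + t * v)%C l /\ Re (l * v)%C = k) ->
     Re (f (p + v)%C) = Re (f p) + k) /\
  ((forall t, 0 <= t <= 1 -> exists l, cder f (p + t * v)%C l /\ Im (l * v)%C = k) ->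
     Im (f (p + v)%C) = Im (f p) + k).
Proof.
  assert (E1 : (p + 1 * v)%C = (p + v)%C) by ring.
  assert (E0 : (p + 0 * v)%C = p) by ring.
  split; intros H.
  - assert (E := is_derive_const_increment (fun t => Re (f (p + t * v)%C)) k).
    cbv beta in E. rewrite E1, E0 in E. apply E.
    intros t Ht. destruct (H t Ht) as (l & Hl & <-). apply (cder_line f p v l t Hl).
  - assert (E := is_derive_const_increment (fun t => Im (f (p + t * v)%C)) k).
    cbv beta in E. rewrite E1, E0 in E. apply E.
    intros t Ht. destruct (H t Ht) as (l & Hl & <-). apply (cder_line f p v l t Hl).
Qed.

(** Schwarz's lemma for [phi z], half of [h (u z) - h (v z)]: it vanishes at 0, and the diameter
    bound gives |phi| <= 1. The pair 1, -1 yields the odd part; unit vectors in other directions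
    yield [diam_circle]. *)
Lemma two_point_schwarz (h : C -> C) (u v : C) :
  (forall z, in_disk z -> exists l, cder h z l) -> diam_image_le h 2 ->
  Cmod u <= 1 -> Cmod v <= 1 ->
  (forall z, in_disk z -> Cmod (h (u * z) - h (v * z))%C <= 2 * Cmod z) /\
  (forall z0, in_disk z0 -> z0 <> 0%C -> Cmod (h (u * z0) - h (v * z0))%C = 2 * Cmod z0 ->
     exists c, Cmod c = 1 /\ forall z, in_disk z -> (h (u * z) - h (v * z) = 2 * (c * z))%C).
Proof.
  intros Hd Hdiam Hu Hv.
  assert (Hin : forall a z, Cmod a <= 1 -> in_disk z -> in_disk (a * z)%C).
  { unfold in_disk. intros a z Ha Hz. rewrite Cmod_mult.
    assert (H1 := Cmod_ge_0 a). assert (H2 := Cmod_ge_0 z). nra. }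
  set (phi := fun z => ((/ 2)%R * (h (u * z) - h (v * z)))%C).
  assert (Hm : forall z, Cmod (phi z) = / 2 * Cmod (h (u * z) - h (v * z))%C).
  { intros z. unfold phi. rewrite Cmod_mult, Cmod_R, Rabs_pos_eq by lra. reflexivity. }
  assert (Hder : forall a z, Cmod a <= 1 -> in_disk z -> exists l, cder (fun w => h (a * w)%C) z l).
  { intros a z Ha Hz. destruct (Hd _ (Hin a z Ha Hz)) as [l Hl]. eexists.
    apply cder_comp with (f := h) (1 := Hl). apply cder_mult; [apply cder_const|apply cder_id]. }
  destruct (schwarz_lemma phi) as [S1 S2].
  - intros z Hz. destruct (Hder u z Hu Hz) as [k Hk]. destruct (Hder v z Hv Hz) as [l Hl].
    eexists. apply cder_mult; [apply cder_const|]. apply cder_minus; [exact Hk|exact Hl].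
  - unfold phi. replace (u * 0)%C with (v * 0)%C by ring. ring.
  - intros z Hz. rewrite Hm. assert (H := Hdiam _ _ (Hin u z Hu Hz) (Hin v z Hv Hz)). lra.
  - split.
    + intros z Hz. specialize (S1 z Hz). rewrite Hm in S1. lra.
    + intros z0 Hz0 Hne E. destruct (S2 z0 Hz0 Hne) as (c & Hc & Hphi); [rewrite Hm; lra|].
      exists c; split; [exact Hc|]. intros z Hz. rewrite <- Hphi by exact Hz.
      unfold phi. rewrite RtoC_inv by lra. field.
Qed.

(** The two-point lemma for the directions of [z] and [w], evaluated at the positive real point
    |z|. *)
Lemma diam_circle (h : C -> C) (z w : C) :
  (forall z, in_disk z -> exists l, cder h z l) -> diam_image_le h 2 ->
  in_disk z -> Cmod w = Cmod z -> Cmod (h z - h w)%C <= 2 * Cmod z.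
Proof.
  intros Hd Hdiam Hz Hw. destruct (Ceq_dec z 0) as [->|Hne].
  - rewrite Cmod_0 in *. apply Cmod_eq_0 in Hw. rewrite Hw.
    replace (h 0 - h 0)%C with (RtoC 0) by ring. rewrite Cmod_0. lra.
  - assert (Hr : 0 < Cmod z) by (apply Cmod_gt_0, Hne).
    assert (Hr' : RtoC (Cmod z) <> 0%C) by (intros E; apply RtoC_inj in E; lra).
    assert (Hrr : Cmod (Cmod z) = Cmod z) by (rewrite Cmod_R; apply Rabs_pos_eq; lra).
    destruct (two_point_schwarz h (z / Cmod z)%C (w / Cmod z)%C Hd Hdiam) as [H _].
    + rewrite Cmod_div, Hrr by exact Hr'. right; field; lra.
    + rewrite Cmod_div, Hrr, Hw by exact Hr'. right; field; lra.
    + specialize (H (Cmod z)). unfold in_disk in H. rewrite Hrr in H. specialize (H Hz).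
      replace (z / Cmod z * Cmod z)%C with z in H by (field; exact Hr').
      replace (w / Cmod z * Cmod z)%C with w in H by (field; exact Hr').
      exact H.
Qed.

Lemma is_derive_at_max (F : R -> R) (t k : R) :
  (forall s, F s <= F t) -> is_derive F t k -> k = 0.
Proof.
  intros Hmax H. apply is_derive_Reals in H.
  apply (deriv_maximum F (t - 1) (t + 1) t (exist _ k H)); [lra|lra|auto].
Qed.

(* On each circle about 0 antipodal points realise the diameter of the image, so
   [t |-> Re (Cconj z * k (z * cexp (0, t)))] is maximal at [t = 0]. *)
Lemma odd_part_id_real_derivative (k : C -> C) (z l : C) :
  (forall z, in_disk z -> exists l, cder k z l) -> diam_image_le k 2 ->
  (forall z, in_disk z -> (k z - k (- z) = 2 * z)%C) ->
  in_disk z -> z <> 0%C -> cder k z l -> Im l = 0.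
Proof.
  intros Hd Hdiam Hodd Hz Hne Hl.
  assert (Hr : 0 < Cmod z) by (apply Cmod_gt_0, Hne).
  set (Psi := fun w => (Cconj z * k (z * cexp w))%C).
  assert (E0 : cexp 0 = 1%C) by (unfold cexp, RtoC; simpl; rewrite exp_0, cos_0, sin_0; f_equal; ring).
  assert (Et : forall t : R, (0 + t * Ci)%C = (0, t))
    by (intros t; unfold Cplus, Cmult, RtoC, Ci; simpl; f_equal; ring).
  assert (HPsi : cder Psi (0 + 0 * Ci)%C (Cconj z * (z * l))%C).
  { replace (0 + 0 * Ci)%C with (RtoC 0) by ring.
    apply cder_eq with (k := (0 * k (z * cexp 0) +
      Cconj z * ((0 * cexp 0 + z * cexp 0) * l))%C); [rewrite E0; ring|].
    apply cder_mult with (f := fun _ => Cconj z) (g := fun w => k (z * cexp w)%C); [apply cder_const|].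
    apply cder_comp with (f := k) (g := fun w => (z * cexp w)%C).
    - rewrite E0, Cmult_1_r. exact Hl.
    - apply cder_mult with (f := fun _ => z) (g := cexp); [apply cder_const|apply cder_cexp]. }
  (* In the direction [Ci] the real part of the derivative is -|z|^2 [Im l]. *)
  destruct (cder_line Psi 0 Ci _ 0 HPsi) as [Hder _].
  apply is_derive_at_max in Hder.
  - repeat rewrite ?re_mult, ?im_mult, ?re_conj, ?im_conj in Hder. simpl in Hder.
    assert (E : Cmod z * Cmod z * Im l = 0) by (rewrite Cmod_sqr; lra).
    apply Rmult_integral in E. destruct E as [E|E]; [nra|exact E].
  - intros t. rewrite !Et. unfold Psi. replace ((0, 0) : C) with (RtoC 0) by reflexivity.
    rewrite E0, Cmult_1_r.
    assert (Hmw : Cmod (z * cexp (0, t))%C = Cmod z).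
    { rewrite Cmod_mult, Cmod_cexp. simpl. rewrite exp_0. ring. }
    set (w := (z * cexp (0, t))%C) in *.
    assert (B := diam_circle k (- z) w Hd Hdiam ltac:(unfold in_disk; rewrite Cmod_opp; exact Hz)
      ltac:(rewrite Cmod_opp; exact Hmw)).
    rewrite Cmod_opp in B.
    (* At [w = z] the oddness relation turns this bound into an equality, which makes t = 0 a
       maximum. *)
    assert (B' : Re (Cconj z * (k w - k (- z)))%C <= Cmod z * (2 * Cmod z)).
    { apply Rle_trans with (1 := Rle_abs _). apply Rle_trans with (1 := re_le_Cmod _).
      rewrite Cmod_mult, Cmod_conj. apply Rmult_le_compat_l; [lra|].
      rewrite <- Cmod_opp. replace (- (k w - k (- z)))%C with (k (- z) - k w)%C by ring. exact B. }
    replace (k (- z)%C) with (k z - 2 * z)%C in B' by (rewrite <- (Hodd z Hz); ring).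
    replace (Cconj z * (k w - (k z - 2 * z)))%C
      with (Cconj z * k w - Cconj z * k z + 2 * (Cconj z * z))%C in B' by ring.
    unfold Cminus in B'. rewrite !re_plus, re_opp, re_scal_l in B'.
    rewrite (re_mult (Cconj z) z), re_conj, im_conj in B'.
    assert (E := Cmod_sqr z). lra.
Qed.

(** At 0 the circle degenerates and the maximum condition says nothing; here the symmetric
    difference quotient (k t - k (-t)) / (2 t), which is identically 1, gives the derivative. *)
Lemma odd_part_id_derivative_0 (k : C -> C) (l : C) :
  (forall z, in_disk z -> (k z - k (- z) = 2 * z)%C) -> cder k 0 l -> l = 1%C.
Proof.
  intros Hodd Hl. apply Ceq_minus, NNPP. intros Hn. apply Cmod_gt_0 in Hn.
  destruct (proj1 (cder_eps _ _ _) Hl (Cmod (l - 1)%C / 2) ltac:(lra)) as (d & Hd & H).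
  set (t := Rmin (d / 2) (/ 2)).
  assert (Ht : 0 < t) by (apply Rmin_pos; lra).
  assert (Ht1 : t <= d / 2) by apply Rmin_l. assert (Ht2 : t <= / 2) by apply Rmin_r.
  assert (Hm : Cmod t = t) by (rewrite Cmod_R; apply Rabs_pos_eq; lra).
  assert (Hm' : Cmod (- t)%C = t) by (rewrite Cmod_opp; exact Hm).
  assert (Ez : forall z : C, (z - 0)%C = z) by (intros z; ring).
  assert (H1 := H t). assert (H2 := H (- t)%C). rewrite !Ez in H1, H2.
  rewrite Hm in H1. rewrite Hm' in H2. specialize (H1 ltac:(lra)). specialize (H2 ltac:(lra)).
  assert (E := Hodd t ltac:(unfold in_disk; lra)).
  assert (T := Cmod_triangle (k t - k 0 - l * t)%C (- (k (- t) - k 0 - l * (- t)))%C).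
  rewrite Cmod_opp in T.
  replace (k t - k 0 - l * t + - (k (- t) - k 0 - l * - t))%C
    with ((k t - k (- t)) - 2 * l * t)%C in T by ring.
  rewrite E in T. rewrite <- (Cmod_opp (2 * t - 2 * l * t)%C) in T.
  replace (- (2 * t - 2 * l * t))%C with (2 * t * (l - 1))%C in T by ring.
  rewrite !Cmod_mult, Hm, Cmod_R, Rabs_pos_eq in T by lra. nra.
Qed.

Lemma Cmod_re_le (x y : R) : Cmod (x, 0) <= Cmod (x, y).
Proof.
  replace ((x, 0) : C) with (RtoC x) by reflexivity.
  rewrite Cmod_R. exact (re_le_Cmod (x, y)).
Qed.

Lemma Cmod_im_le (x y : R) : Cmod (0, y) <= Cmod (x, y).
Proof.
  unfold Cmod; simpl. apply sqrt_le_1_alt. nra.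
Qed.

(* Landau-Toeplitz rigidity: [k'] is real on the disk, so [Re k] depends only on [x] and
   [Im k] only on [y], and by Cauchy-Riemann their derivatives agree everywhere. *)
Lemma odd_part_id_rigid (k : C -> C) :
  (forall z, in_disk z -> exists l, cder k z l) -> diam_image_le k 2 ->
  (forall z, in_disk z -> (k z - k (- z) = 2 * z)%C) ->
  forall z, in_disk z -> k z = (z + k 0)%C.
Proof.
  intros Hd Hdiam Hodd.
  assert (Hreal : forall z, in_disk z -> exists l : R, cder k z l).
  { intros z Hz. destruct (Hd z Hz) as [l Hl].
    assert (Im l = 0).
    { destruct (Ceq_dec z 0) as [->|Hne].
      - rewrite (odd_part_id_derivative_0 k l Hodd Hl). reflexivity.
      - apply (odd_part_id_real_derivative k z l Hd Hdiam Hodd Hz Hne Hl). }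
    exists (Re l). replace (RtoC (Re l)) with l; [exact Hl|].
    destruct l as [a b]; simpl in *. subst b. reflexivity. }
  (* The vertical derivative of [Re k] is the real part of [l * Ci], which is 0 for real [l]. *)
  assert (Hre : forall x y, in_disk (x, y) -> Re (k (x, y)) = Re (k (x, 0))).
  { intros x y Hxy.
    assert (E := proj1 (cder_segment k (x, 0) (0, y) 0)).
    replace ((x, 0) + (0, y))%C with ((x, y) : C) in E by (unfold Cplus; simpl; f_equal; ring).
    rewrite Rplus_0_r in E. apply E. intros t Ht.
    destruct (Hreal ((x, 0) + t * (0, y))%C) as [l Hl].
    - assert (P := segment_in_disk (x, 0) (x, y) 1 t
        (Rle_lt_trans _ _ _ (Cmod_re_le x y) Hxy) Hxy Ht).
      replace ((x, y) - (x, 0))%C with ((0, y) : C) in P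
        by (unfold Cminus, Cplus, Copp; simpl; f_equal; ring). exact P.
    - exists l; split; [exact Hl|]. rewrite re_scal_l. simpl. ring. }
  assert (Him : forall x y, in_disk (x, y) -> Im (k (x, y)) = Im (k (0, y))).
  { intros x y Hxy.
    assert (E := proj2 (cder_segment k (0, y) (x, 0) 0)).
    replace ((0, y) + (x, 0))%C with ((x, y) : C) in E by (unfold Cplus; simpl; f_equal; ring).
    rewrite Rplus_0_r in E. apply E. intros t Ht.
    destruct (Hreal ((0, y) + t * (x, 0))%C) as [l Hl].
    - assert (P := segment_in_disk (0, y) (x, y) 1 t
        (Rle_lt_trans _ _ _ (Cmod_im_le x y) Hxy) Hxy Ht).
      replace ((x, y) - (0, y))%C with ((x, 0) : C) in P
        by (unfold Cminus, Cplus, Copp; simpl; f_equal; ring). exact P.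
    - exists l; split; [exact Hl|]. rewrite im_scal_l. simpl. ring. }
  assert (H0 : cder k 0 1).
  { destruct (Hd 0%C) as [l Hl]; [unfold in_disk; rewrite Cmod_0; lra|].
    rewrite <- (odd_part_id_derivative_0 k l Hodd Hl). exact Hl. }
  assert (Ex : forall x y s : R, ((x, y) + s * 1)%C = (x + s, y)%R)
    by (intros; unfold Cplus, Cmult, RtoC; simpl; f_equal; ring).
  assert (Ey : forall x y s : R, ((x, y) + s * Ci)%C = (x, y + s)%R)
    by (intros; unfold Cplus, Cmult, RtoC, Ci; simpl; f_equal; ring).
  assert (Hnear : forall x y u v : R, in_disk (x, y) -> Rabs u + Rabs v < 1 - Cmod (x, y) ->
    in_disk ((x + u)%R, (y + v)%R)).
  { intros x y u v Hxy Huv. unfold in_disk in *.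
    replace (((x + u)%R, (y + v)%R) : C) with ((x, y) + (u, v))%C by reflexivity.
    apply Rle_lt_trans with (1 := Cmod_triangle _ _).
    assert (B := Cmod_pair_le u v). lra. }
  (* [l] is also the vertical derivative of [Im k] at (x, 0). By [Him] that function is the same as
     on the imaginary axis, where its derivative at 0 is 1. *)
  assert (Hx1 : forall x (l : R), in_disk (x, 0) -> cder k (x, 0) l -> l = 1).
  { intros x l Hx Hl.
    destruct (cder_line k (x, 0) Ci l 0) as [_ D1].
    { replace ((x, 0) + 0 * Ci)%C with ((x, 0) : C) by (rewrite Ey; f_equal; ring). exact Hl. }
    destruct (cder_line k (0, 0) Ci 1 0) as [_ D2].
    { replace ((0, 0) + 0 * Ci)%C with (RtoC 0) by (rewrite Ey, Rplus_0_r; reflexivity). exact H0. }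
    rewrite im_scal_l in D1, D2. simpl in D1, D2.
    assert (D3 : is_derive (fun s : R => Im (k ((0, 0) + s * Ci)%C)) 0 (l * 1)).
    { apply is_derive_ext_loc with (2 := D1).
      assert (Hp : 0 < 1 - Cmod (x, 0)) by (unfold in_disk in Hx; lra).
      exists (mkposreal _ Hp). intros s Hs.
      assert (Hs' : Rabs s < 1 - Cmod (x, 0)).
      { replace s with (s - 0) by ring. exact Hs. }
      rewrite !Ey. apply Him.
      replace x with (x + 0) by ring. apply Hnear; [exact Hx|]. rewrite Rabs_R0. lra. }
    apply is_derive_unique in D2, D3. rewrite D2 in D3. lra. }
  assert (Hy1 : forall y (l : R), in_disk (0, y) -> cder k (0, y) l -> l = 1).
  { intros y l Hy Hl.
    destruct (cder_line k (0, y) 1 l 0) as [D1 _].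
    { replace ((0, y) + 0 * 1)%C with ((0, y) : C) by (rewrite Ex; f_equal; ring). exact Hl. }
    destruct (cder_line k (0, 0) 1 1 0) as [D2 _].
    { replace ((0, 0) + 0 * 1)%C with (RtoC 0) by (rewrite Ex, Rplus_0_r; reflexivity). exact H0. }
    rewrite re_scal_l in D1, D2. simpl in D1, D2.
    assert (D3 : is_derive (fun s : R => Re (k ((0, 0) + s * 1)%C)) 0 (l * 1)).
    { apply is_derive_ext_loc with (2 := D1).
      assert (Hp : 0 < 1 - Cmod (0, y)) by (unfold in_disk in Hy; lra).
      exists (mkposreal _ Hp). intros s Hs.
      assert (Hs' : Rabs s < 1 - Cmod (0, y)).
      { replace s with (s - 0) by ring. exact Hs. }
      rewrite !Ex. apply Hre.
      replace y with (y + 0) by ring. apply Hnear; [exact Hy|]. rewrite Rabs_R0. lra. }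
    apply is_derive_unique in D2, D3. rewrite D2 in D3. lra. }
  assert (Hdisk0 : in_disk (0, 0)) by (unfold in_disk; change ((0, 0) : C) with (RtoC 0); rewrite Cmod_0; lra).
  assert (Hp : forall x, in_disk (x, 0) -> Re (k (x, 0)) = Re (k (0, 0)) + x).
  { intros x Hx. assert (E := proj1 (cder_segment k (0, 0) (x, 0) x)).
    replace ((0, 0) + (x, 0))%C with ((x, 0) : C) in E by (unfold Cplus; simpl; f_equal; ring).
    apply E. intros t Ht.
    assert (Et : ((0, 0) + t * (x, 0))%C = (t * x, 0)%R)
      by (unfold Cplus, Cmult, RtoC; simpl; f_equal; ring).
    assert (P := segment_in_disk (0, 0) (x, 0) 1 t Hdisk0 Hx Ht).
    replace ((x, 0) - (0, 0))%C with ((x, 0) : C) in P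
      by (unfold Cminus, Cplus, Copp; simpl; f_equal; ring).
    rewrite Et in *. destruct (Hreal _ P) as [l Hl].
    exists l; split; [exact Hl|]. rewrite (Hx1 _ l P Hl), re_scal_l. simpl. ring. }
  assert (Hq : forall y, in_disk (0, y) -> Im (k (0, y)) = Im (k (0, 0)) + y).
  { intros y Hy. assert (E := proj2 (cder_segment k (0, 0) (0, y) y)).
    replace ((0, 0) + (0, y))%C with ((0, y) : C) in E by (unfold Cplus; simpl; f_equal; ring).
    apply E. intros t Ht.
    assert (Et : ((0, 0) + t * (0, y))%C = (0, t * y)%R)
      by (unfold Cplus, Cmult, RtoC; simpl; f_equal; ring).
    assert (P := segment_in_disk (0, 0) (0, y) 1 t Hdisk0 Hy Ht).
    replace ((0, y) - (0, 0))%C with ((0, y) : C) in P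
      by (unfold Cminus, Cplus, Copp; simpl; f_equal; ring).
    rewrite Et in *. destruct (Hreal _ P) as [l Hl].
    exists l; split; [exact Hl|]. rewrite (Hy1 _ l P Hl), im_scal_l. simpl. ring. }
  intros [x y] Hz.
  assert (E1 : Re (k (x, y)) = Re (k 0) + x).
  { rewrite (Hre x y Hz). apply Hp. exact (Rle_lt_trans _ _ _ (Cmod_re_le x y) Hz). }
  assert (E2 : Im (k (x, y)) = Im (k 0) + y).
  { rewrite (Him x y Hz). apply Hq. exact (Rle_lt_trans _ _ _ (Cmod_im_le x y) Hz). }
  destruct (k (x, y)) as [a b]. destruct (k 0) as [a0 b0]. simpl in E1, E2. subst.
  unfold Cplus; simpl. f_equal; ring.
Qed.

Lemma landau_toeplitz_rigidity (h : C -> C) (c : C) :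
  (forall z, in_disk z -> exists l, cder h z l) -> diam_image_le h 2 -> Cmod c = 1 ->
  (forall z, in_disk z -> (h z - h (- z) = 2 * (c * z))%C) ->
  forall z, in_disk z -> h z = (c * z + h 0)%C.
Proof.
  intros Hd Hdiam Hc Hodd z Hz.
  assert (Hcc : (c * Cconj c)%C = 1%C).
  { rewrite <- Cmod2_conj, Hc. f_equal. ring. }
  assert (E := odd_part_id_rigid (fun w => Cconj c * h w)%C).
  replace (h z) with (c * (Cconj c * h z))%C
    by (rewrite Cmult_assoc, Hcc; ring).
  rewrite E; [| | | |exact Hz].
  - replace (c * (z + Cconj c * h 0))%C with (c * z + (c * Cconj c) * h 0)%C by ring.
    rewrite Hcc. ring.
  - intros w Hw. destruct (Hd w Hw) as [l Hl]. eexists.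
    apply cder_mult; [apply cder_const|exact Hl].
  - intros u w Hu Hw. replace (Cconj c * h u - Cconj c * h w)%C with (Cconj c * (h u - h w))%C by ring.
    rewrite Cmod_mult, Cmod_conj, Hc, Rmult_1_l. apply Hdiam; assumption.
  - intros w Hw. replace (Cconj c * h w - Cconj c * h (- w))%C with (Cconj c * (h w - h (- w)))%C by ring.
    rewrite Hodd by exact Hw. replace (Cconj c * (2 * (c * w)))%C with (2 * ((c * Cconj c) * w))%C by ring.
    rewrite Hcc. ring.
Qed.

(** * Disk automorphisms *)

Definition moebius (b z : C) : C := ((z + b) / (1 + Cconj b * z))%C.

(** Both claims follow from |1 + conj(b) z|^2 - |z + b|^2 = (1 - |b|^2)(1 - |z|^2) > 0. *)
Lemma moebius_disk (b z : C) : in_disk b -> in_disk z ->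
  (1 + Cconj b * z)%C <> 0%C /\ in_disk (moebius b z).
Proof.
  unfold in_disk. intros Hb Hz.
  assert (K : Cmod (z + b)%C < Cmod (1 + Cconj b * z)%C).
  { assert (Eb := Cmod_sqr b). assert (Ez := Cmod_sqr z).
    assert (E1 := Cmod_sqr (z + b)%C). assert (E2 := Cmod_sqr (1 + Cconj b * z)%C).
    rewrite !re_plus, !im_plus, re_mult, im_mult, re_conj, im_conj in *. simpl (Re 1) in E2. simpl (Im 1) in E2.
    assert (Pb := Cmod_ge_0 b). assert (Pz := Cmod_ge_0 z).
    assert (P : 0 < (1 - Cmod b * Cmod b) * (1 - Cmod z * Cmod z)) by (apply Rmult_lt_0_compat; nra).
    rewrite Eb, Ez in P.
    apply Rsqr_incrst_0; [unfold Rsqr; rewrite E1, E2; lra|apply Cmod_ge_0|apply Cmod_ge_0]. }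
  assert (H0 := Cmod_ge_0 (z + b)%C).
  assert (Hne : (1 + Cconj b * z)%C <> 0%C) by (apply Cmod_gt_0; lra).
  split; [exact Hne|]. unfold moebius. rewrite Cmod_div by exact Hne.
  apply Rmult_lt_reg_r with (Cmod (1 + Cconj b * z)%C); [lra|].
  unfold Rdiv. rewrite Rmult_assoc, Rinv_l by lra. lra.
Qed.

Lemma moebius_cder (b z : C) : in_disk b -> in_disk z -> exists l, cder (moebius b) z l.
Proof.
  intros Hb Hz. apply (cder_div (fun w => w + b)%C (fun w => 1 + Cconj b * w)%C z (1 + 0)%C
    (0 + (0 * z + Cconj b * 1))%C).
  - apply moebius_disk; assumption.
  - apply cder_plus; [apply cder_id|apply cder_const].
  - apply cder_plus; [apply cder_const|].
    apply cder_mult with (f := fun _ => Cconj b) (g := fun w => w); [apply cder_const|apply cder_id].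
Qed.

Lemma in_disk_opp (b : C) : in_disk b -> in_disk (- b)%C.
Proof. unfold in_disk. rewrite Cmod_opp. auto. Qed.

Lemma moebius_opp_r (b : C) : moebius b (- b)%C = 0%C.
Proof. unfold moebius. replace (- b + b)%C with (RtoC 0) by ring. unfold Cdiv. ring. Qed.

Lemma moebius_inverse (b z : C) : in_disk b -> in_disk z -> moebius b (moebius (- b) z) = z.
Proof.
  intros Hb Hz. destruct (moebius_disk (- b) z (in_disk_opp b Hb) Hz) as [N1 D].
  destruct (moebius_disk b _ Hb D) as [N2 _].
  unfold moebius in *. rewrite Copp_conj in *.
  (* The denominator in [N2] equals (1 - |b|^2) / (1 - conj(b) z), so its nonvanishing carries
     over. *)
  assert (N3 : (1 - Cconj b * b)%C <> 0%C).
  { intros E. apply N2. field_simplify_eq; [|exact N1].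
    transitivity (1 - Cconj b * b)%C; [ring|exact E]. }
  field. split; [exact N1|].
  intros E. apply N3. rewrite <- E. ring.
Qed.

Lemma moebius_self (b : C) : in_disk b ->
  moebius b b = (RtoC (2 / (1 + Cmod b ^ 2)) * b)%C.
Proof.
  intros Hb. assert (P := pow2_ge_0 (Cmod b)).
  assert (N : (1 + Cmod b ^ 2)%R <> 0) by lra.
  unfold moebius. rewrite (Cmult_comm (Cconj b)), <- Cmod2_conj, <- RtoC_plus, RtoC_div by exact N.
  field. intros E; apply RtoC_inj in E; contradiction.
Qed.

Lemma sqrt_one_minus_double (s : R) : 0 <= s < 1 ->
  sqrt (1 - (2 * s / (1 + s ^ 2)) ^ 2) = (1 - s ^ 2) / (1 + s ^ 2).
Proof.
  intros Hs. assert (0 <= s ^ 2 < 1) by (simpl; nra).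
  replace (1 - (2 * s / (1 + s ^ 2)) ^ 2) with (Rsqr ((1 - s ^ 2) / (1 + s ^ 2)))
    by (unfold Rsqr; field; lra).
  apply sqrt_Rsqr. apply Rdiv_le_0_compat; lra.
Qed.

(** Origin of the square root in the bound: with s = |b| the image has modulus 2s / (1 + s^2), and 1
    plus the root is 2 / (1 + s^2). *)
Lemma dist_bound_moebius (b : C) : in_disk b -> dist_bound (moebius b b) = 2 * Cmod b.
Proof.
  intros Hb. assert (Hs : 0 <= Cmod b < 1) by (split; [apply Cmod_ge_0|exact Hb]).
  assert (0 <= Cmod b ^ 2 < 1) by (simpl; nra).
  assert (E : Cmod (moebius b b) = 2 * Cmod b / (1 + Cmod b ^ 2)).
  { rewrite moebius_self by exact Hb. rewrite Cmod_mult, Cmod_R, Rabs_pos_eq.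
    - field. lra.
    - apply Rdiv_le_0_compat; lra. }
  unfold dist_bound. rewrite E, sqrt_one_minus_double by exact Hs. field. lra.
Qed.

Lemma moebius_midpoint (z : C) : in_disk z ->
  exists b, in_disk b /\ moebius b b = z /\ (b = 0%C -> z = 0%C).
Proof.
  intros Hz. assert (Hr : 0 <= Cmod z < 1) by (split; [apply Cmod_ge_0|exact Hz]).
  set (S := sqrt (1 - Cmod z ^ 2)).
  assert (HS0 : 0 <= S) by apply sqrt_pos.
  assert (HS : S * S = 1 - Cmod z ^ 2) by (apply sqrt_sqrt; simpl; nra).
  (* |b| is the root in [0, 1) of 2s / (1 + s^2) = |z|. *)
  set (b := (RtoC (/ (1 + S)) * z)%C).
  assert (HSp : 0 < / (1 + S)) by (apply Rinv_0_lt_compat; lra).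
  assert (Hb : Cmod b = / (1 + S) * Cmod z)
    by (unfold b; rewrite Cmod_mult, Cmod_R, Rabs_pos_eq by lra; reflexivity).
  assert (Hin : in_disk b).
  { unfold in_disk. rewrite Hb.
    assert (/ (1 + S) <= 1) by (rewrite <- Rinv_1; apply Rinv_le_contravar; lra). nra. }
  exists b. split; [exact Hin|split].
  - rewrite moebius_self by exact Hin. unfold b at 2. rewrite Cmult_assoc, <- RtoC_mult, Hb.
    replace (2 / (1 + (/ (1 + S) * Cmod z) ^ 2) * / (1 + S)) with 1; [ring|].
    rewrite Rpow_mult_distr. replace (Cmod z ^ 2) with (1 - S * S) by lra.
    field. split; nra.
  - intros E. apply Cmod_eq_0. rewrite E, Cmod_0 in Hb. nra.
Qed.

Lemma moebius_comp_cder (f : C -> C) (b : C) : in_disk b -> analytic_on_disk f ->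
  forall z, in_disk z -> exists l, cder (fun w => f (moebius b w)) z l.
Proof.
  intros Hb Hf z Hz. destruct (moebius_disk b z Hb Hz) as [_ D].
  destruct (ex_derive_cder f _ (Hf _ D)) as [k Hk].
  destruct (moebius_cder b z Hb Hz) as [l Hl].
  eexists. apply cder_comp with (1 := Hk) (2 := Hl).
Qed.

(** * The distance bound and its extremal maps *)

Theorem theorem8p1 (f : C -> C) :
  analytic_on_disk f ->
  diam_image_le f 2 ->
  (forall z : C, in_disk z -> Cmod (f z - f 0)%C <= dist_bound z) /\
  ((exists z : C, in_disk z /\ z <> 0%C /\ Cmod (f z - f 0)%C = dist_bound z) <->
   (exists (a b c : C),
      in_disk b /\ b <> 0%C /\ Cmod c = 1 /\
      forall z : C, in_disk z ->
        f z = (c * ((z - b) / (1 - Cconj b * z)) + a)%C)).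
Proof.
  intros Hf Hdiam.
  assert (Hmob : forall b z, moebius (- b) z = ((z - b) / (1 - Cconj b * z))%C).
  { intros b z. unfold moebius. rewrite Copp_conj. f_equal; ring. }
  assert (Hschwarz : forall b, in_disk b ->
    let h := fun w => f (moebius b w) in
    (forall w, in_disk w -> exists l, cder h w l) /\ diam_image_le h 2 /\
    (forall w, in_disk w -> Cmod (h w - h (- w))%C <= 2 * Cmod w) /\
    (forall w, in_disk w -> w <> 0%C -> Cmod (h w - h (- w))%C = 2 * Cmod w ->
       exists c, Cmod c = 1 /\ forall w, in_disk w -> (h w - h (- w) = 2 * (c * w))%C)).
  { intros b Hb h.
    assert (Hd := moebius_comp_cder f b Hb Hf).
    assert (HD : diam_image_le h 2).
    { intros u v Hu Hv. apply Hdiam; apply moebius_disk; assumption. }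
    split; [exact Hd|split; [exact HD|]].
    destruct (two_point_schwarz h 1 (- (1))%C Hd HD) as [S1 S2].
    { rewrite Cmod_1; lra. }
    { rewrite Cmod_m1; lra. }
    assert (E : forall w, (h (1 * w) - h (- (1) * w) = h w - h (- w))%C).
    { intros w. do 2 f_equal; try f_equal; ring. }
    split.
    - intros w Hw. rewrite <- E. apply S1, Hw.
    - intros w Hw Hne. rewrite <- E. intros Heq. destruct (S2 w Hw Hne Heq) as (c & Hc & H).
      exists c; split; [exact Hc|]. intros v Hv. rewrite <- E. apply H, Hv. }
  split; [|split].
  - intros z Hz. destruct (moebius_midpoint z Hz) as (b & Hb & <- & _).
    destruct (Hschwarz b Hb) as (_ & _ & S1 & _).
    specialize (S1 b Hb). cbv beta in S1. rewrite moebius_opp_r in S1.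
    rewrite dist_bound_moebius by exact Hb. exact S1.
  - intros (z & Hz & Hne & Heq). destruct (moebius_midpoint z Hz) as (b & Hb & Ez & Hb0).
    destruct (Hschwarz b Hb) as (Hd & HD & _ & S2).
    assert (Hbne : b <> 0%C) by auto.
    destruct (S2 b Hb Hbne) as (c & Hc & Hodd).
    { rewrite moebius_opp_r, Ez, Heq, <- Ez. apply dist_bound_moebius, Hb. }
    assert (Haff := landau_toeplitz_rigidity _ c Hd HD Hc Hodd). cbv beta in Haff.
    (* Rigidity gives h w = c w + h 0; undoing the substitution with [moebius (- b)] keeps [b] and
       [c] and makes [h 0] the constant [a]. *)
    exists (f (moebius b 0)), b, c. repeat split; auto.
    intros w Hw. rewrite <- Hmob, <- Haff by (apply moebius_disk; [apply in_disk_opp, Hb|exact Hw]).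
    rewrite moebius_inverse by assumption. reflexivity.
  - intros (a & b & c & Hb & Hbne & Hc & H).
    assert (Hbb : in_disk (moebius b b)) by (apply moebius_disk; exact Hb).
    assert (Hp : 0 < Cmod b) by (apply Cmod_gt_0, Hbne).
    (* [moebius (- b)] sends this point to [b] and 0 to [- b], so the values of [f] differ by 2 c b,
       of modulus 2|b|. *)
    exists (moebius b b). split; [exact Hbb|split].
    + intros E. assert (E' := dist_bound_moebius b Hb). rewrite E in E'.
      unfold dist_bound in E'. rewrite Cmod_0 in E'. lra.
    + rewrite dist_bound_moebius by exact Hb.
      assert (Ebb : moebius (- b) (moebius b b) = b).
      { assert (E := moebius_inverse (- b) b (in_disk_opp b Hb) Hb).
        replace (- - b)%C with b in E by ring. exact E. }
      rewrite !H, <- !Hmob, Ebb by (exact Hbb || (unfold in_disk; rewrite Cmod_0; lra)).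
      replace (moebius (- b) 0) with (- b)%C
        by (unfold moebius; replace (1 + Cconj (- b) * 0)%C with (RtoC 1) by ring; field;
            intros E; apply RtoC_inj in E; lra).
      replace (c * b + a - (c * - b + a))%C with (c * (2 * b))%C by ring.
      rewrite !Cmod_mult, Hc, Cmod_R, Rabs_pos_eq by lra. ring.
Qed.
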